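(* Let $0<q<1$ and $\tau,\rho\in\mathbb{R}$. The matrix $A(\tau,\rho)$, considered as a (potentially unbounded) linear operator on $\ell^2(\mathbb{N}_0)$, has the following properties. (1) If $\tau>0$, then $A(\tau,\rho)$ is positive semi-definite. Moreover, for $\tau>0$: (a) if $\rho>0$, then $A(\tau,\rho)$ is bounded, compact and trace class; (b) if $\rho=0$, then $A(\tau,\rho)$ is bounded but not compact; (c) if $\rho<0$, then $A(\tau,\rho)$ is unbounded. (2) If $\tau=0$, then $A(\tau,\rho)$ is formally rank one, and it is bounded if and only if $\rho>0$. (3) If $\tau<0$, then $A(\tau,\rho)$ is bounded if and only if $\rho+\tau>0$; in this case it is also compact and trace class.
   Context: Here $\mathbb{N}_0=\{0,1,2,\dots\}$. For $0<q<1$ and real $\tau,\rho$, $A(\tau,\rho)$ is the semi-infinite matrix indexed by $n,m\in\mathbb{N}_0$ with entries $$[A(\tau,\rho)]_{n,m}=\frac{q^{\tau(n\vee m)}}{q^{\tau(n+m)/2}}\,q^{\rho(n+m)/2},$$ where $n\vee m=\max\{n,m\}$. ''Bounded'' means that the matrix is the matrix, in the standard basis, of a bounded linear operator on $\ell^2(\mathbb{N}_0)$; ''unbounded'' means that it is not. ''Positive semi-definite'' means that $\sum_{n,m}[A(\tau,\rho)]_{n,m}f_n\overline{f_m}\ge 0$ for all finitely supported complex sequences $(f_n)_{n\in\mathbb{N}_0}$. ''Formally rank one'' means that the entries have the form $u_nu_m$ for some non-zero sequence $(u_n)_{n\in\mathbb{N}_0}$, not necessarily in $\ell^2(\mathbb{N}_0)$.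 *)

(* Defs.v *)
From Stdlib Require Import Reals Lra Lia FunctionalExtensionality ProofIrrelevance.
From Coquelicot Require Import Coquelicot.

Open Scope R_scope.

Record ell2 : Type := Ell2 {
  ell2_val :> nat -> C;
  ell2_summable : ex_series (fun n => Cmod (ell2_val n) ^ 2)
}.

Lemma ell2_eq (f g : ell2) : (forall n, f n = g n) -> f = g.
Proof.
destruct f as [f hf], g as [g hg]; simpl; intros H.
assert (E : f = g) by now apply functional_extensionality.
subst g; f_equal; apply proof_irrelevance.
Qed.

Lemma Cmod_add_sqr_le (t : R) (z w : C) : 0 < t ->
  Cmod (z + w)%C ^ 2 <= (1 + t) * Cmod z ^ 2 + (1 + / t) * Cmod w ^ 2.
Proof.
intros ht.
assert (H := Cmod_triangle z w).
assert (H0 := Cmod_ge_0 (z + w)%C).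
apply Rle_trans with ((Cmod z + Cmod w) ^ 2).
{ apply pow_incr; lra. }
assert (E : (1 + t) * Cmod z ^ 2 + (1 + / t) * Cmod w ^ 2 -
            (Cmod z + Cmod w) ^ 2 = / t * (t * Cmod z - Cmod w) ^ 2)
  by (field; lra).
assert (P : 0 <= / t * (t * Cmod z - Cmod w) ^ 2).
{ apply Rmult_le_pos.
  - left; now apply Rinv_0_lt_compat.
  - apply pow2_ge_0. }
lra.
Qed.

Lemma summable_dominated (f : nat -> C) (b : nat -> R) :
  (forall n, Cmod (f n) ^ 2 <= b n) -> ex_series b ->
  ex_series (fun n => Cmod (f n) ^ 2).
Proof.
intros H Hb.
apply (@ex_series_le R_AbsRing R_CompleteNormedModule _ b); [|exact Hb].
intros n; unfold norm; simpl; unfold abs; simpl.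
rewrite Rabs_pos_eq; [apply H|apply (pow2_ge_0 (Cmod (f n)))].
Qed.

Lemma summable_comb (f g : ell2) (a b : R) :
  ex_series (fun n => a * Cmod (f n) ^ 2 + b * Cmod (g n) ^ 2).
Proof.
apply (@ex_series_plus R_AbsRing R_NormedModule
         (fun n => a * Cmod (f n) ^ 2) (fun n => b * Cmod (g n) ^ 2)).
- apply (@ex_series_scal R_AbsRing R_NormedModule); apply ell2_summable.
- apply (@ex_series_scal R_AbsRing R_NormedModule); apply ell2_summable.
Qed.

Lemma ell2_plus_summable (f g : ell2) :
  ex_series (fun n => Cmod (f n + g n)%C ^ 2).
Proof.
apply summable_dominated
  with (fun n => (1 + 1) * Cmod (f n) ^ 2 + (1 + / 1) * Cmod (g n) ^ 2).
- intros n; apply Cmod_add_sqr_le; lra.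
- apply summable_comb.
Qed.

Lemma ell2_scal_summable (c : C) (f : ell2) :
  ex_series (fun n => Cmod (c * f n)%C ^ 2).
Proof.
apply summable_dominated
  with (fun n => Cmod c ^ 2 * Cmod (f n) ^ 2 + 0 * Cmod (f n) ^ 2).
- intros n; rewrite Cmod_mult; right; ring.
- apply summable_comb.
Qed.

Lemma ell2_opp_summable (f : ell2) : ex_series (fun n => Cmod (- f n)%C ^ 2).
Proof.
apply summable_dominated
  with (fun n => 1 * Cmod (f n) ^ 2 + 0 * Cmod (f n) ^ 2).
- intros n; rewrite Cmod_opp; right; ring.
- apply summable_comb.
Qed.

Lemma single_summable (c : C) (m : nat) :
  ex_series (fun n => Cmod (if Nat.eqb n m then c else RtoC 0) ^ 2).
Proof.
apply ex_series_incr_n with (S m).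
apply summable_dominated with (fun _ => 0).
- intros n; replace (Nat.eqb (S m + n) m) with false.
  + rewrite Cmod_0; right; ring.
  + symmetry; apply Nat.eqb_neq; lia.
- exists 0; apply filterlim_ext with (fun _ => 0).
  + intros n; rewrite sum_n_const; ring.
  + apply filterlim_const.
Qed.

Lemma ell2_zero_summable : ex_series (fun _ : nat => Cmod (RtoC 0) ^ 2).
Proof.
generalize (single_summable (RtoC 0) 0%nat); apply ex_series_ext.
now intros n; destruct (Nat.eqb n 0).
Qed.

Definition ell2_plus (f g : ell2) : ell2 := Ell2 _ (ell2_plus_summable f g).
Definition ell2_opp (f : ell2) : ell2 := Ell2 _ (ell2_opp_summable f).
Definition ell2_zero : ell2 := Ell2 _ ell2_zero_summable.
Definition ell2_scal (c : C) (f : ell2) : ell2 := Ell2 _ (ell2_scal_summable c f).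

Definition ell2_norm (f : ell2) : R :=
  sqrt (Series (fun n => Cmod (f n) ^ 2)).

Definition ell2_AbelianMonoid_mixin : AbelianMonoid.mixin_of ell2.
Proof.
apply (AbelianMonoid.Mixin ell2 ell2_plus ell2_zero);
  intros; apply ell2_eq; intros n; simpl; ring.
Defined.

Canonical ell2_AbelianMonoid :=
  AbelianMonoid.Pack ell2 ell2_AbelianMonoid_mixin ell2.

Definition ell2_AbelianGroup_mixin : AbelianGroup.mixin_of ell2_AbelianMonoid.
Proof.
apply (AbelianGroup.Mixin ell2_AbelianMonoid ell2_opp).
intros; apply ell2_eq; intros n; simpl; ring.
Defined.

Canonical ell2_AbelianGroup :=
  AbelianGroup.Pack ell2
    (AbelianGroup.Class _ ell2_AbelianMonoid_mixin ell2_AbelianGroup_mixin) ell2.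

Definition ell2_ModuleSpace_mixin :
  ModuleSpace.mixin_of C_Ring ell2_AbelianGroup.
Proof.
apply (ModuleSpace.Mixin C_Ring ell2_AbelianGroup ell2_scal);
  intros; apply ell2_eq; intros n;
  unfold ell2_scal, plus, mult, one; simpl; ring.
Defined.

Canonical ell2_ModuleSpace :=
  ModuleSpace.Pack C_Ring ell2
    (ModuleSpace.Class C_Ring _ _ ell2_ModuleSpace_mixin) ell2.

Lemma ell2_Series_pos (f : ell2) : 0 <= Series (fun n => Cmod (f n) ^ 2).
Proof.
assert (E : Series (fun _ : nat => 0) = 0).
{ rewrite <- (Series_ext (fun n => 0 * 0)); [|intros; ring].
  rewrite Series_scal_l; ring. }
rewrite <- E.
apply Series_le; [|apply ell2_summable].
intros n; split; [lra|apply (pow2_ge_0 (Cmod (f n)))].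
Qed.

Lemma ell2_norm_sqr (f : ell2) :
  ell2_norm f ^ 2 = Series (fun n => Cmod (f n) ^ 2).
Proof. unfold ell2_norm; apply pow2_sqrt, ell2_Series_pos. Qed.

Lemma ell2_coord_le (f : ell2) (n : nat) : Cmod (f n) <= ell2_norm f.
Proof.
apply Rsqr_incr_0_var; [rewrite !Rsqr_pow2|apply sqrt_pos].
rewrite ell2_norm_sqr.
assert (H : is_lim_seq (sum_n (fun k => Cmod (f k) ^ 2))
              (Series (fun k => Cmod (f k) ^ 2))).
{ apply Series_correct, ell2_summable. }
apply Rle_trans with (sum_n (fun k => Cmod (f k) ^ 2) n).
- destruct n as [|n].
  + rewrite sum_O; lra.
  + rewrite sum_Sn; unfold plus; simpl.
    assert (0 <= sum_n (fun k => Cmod (f k) ^ 2) n); [|simpl in *; lra].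
    rewrite sum_n_Reals; apply cond_pos_sum.
    intros k; apply (pow2_ge_0 (Cmod (f k))).
- apply (is_lim_seq_incr_compare _ _ H).
  intros k; rewrite sum_Sn; unfold plus; simpl.
  assert (h := pow2_ge_0 (Cmod (f (S k)))); simpl in h; lra.
Qed.

Lemma ell2_norm_eq0 (f : ell2) : ell2_norm f = 0 -> f = ell2_zero.
Proof.
intros H; apply ell2_eq; intros n; simpl; apply Cmod_eq_0.
generalize (ell2_coord_le f n) (Cmod_ge_0 (f n)); lra.
Qed.

Lemma ell2_norm_triangle (f g : ell2) :
  ell2_norm (ell2_plus f g) <= ell2_norm f + ell2_norm g.
Proof.
assert (hf : 0 <= ell2_norm f) by apply sqrt_pos.
assert (hg : 0 <= ell2_norm g) by apply sqrt_pos.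
destruct hf as [hf|hf].
2:{ rewrite (ell2_norm_eq0 f (eq_sym hf)).
    replace (ell2_plus ell2_zero g) with g
      by (apply ell2_eq; intros n; simpl; ring).
    generalize (sqrt_pos (Series (fun n => Cmod (ell2_zero n) ^ 2))).
    unfold ell2_norm at 2; lra. }
destruct hg as [hg|hg].
2:{ rewrite (ell2_norm_eq0 g (eq_sym hg)).
    replace (ell2_plus f ell2_zero) with f
      by (apply ell2_eq; intros n; simpl; ring).
    generalize (sqrt_pos (Series (fun n => Cmod (ell2_zero n) ^ 2))).
    unfold ell2_norm at 3; lra. }
apply Rsqr_incr_0_var; [rewrite !Rsqr_pow2|lra].
set (t := ell2_norm g / ell2_norm f).
assert (ht : 0 < t) by now apply Rdiv_lt_0_compat.
assert (E : (ell2_norm f + ell2_norm g) ^ 2 =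
            (1 + t) * ell2_norm f ^ 2 + (1 + / t) * ell2_norm g ^ 2)
  by (unfold t; field; lra).
rewrite E, !ell2_norm_sqr, <- !Series_scal_l.
rewrite <- (Series_plus (fun n => (1 + t) * Cmod (f n) ^ 2)
                        (fun n => (1 + / t) * Cmod (g n) ^ 2)).
- apply Series_le; [|apply summable_comb].
  intros n; split; [apply (pow2_ge_0 (Cmod _))|].
  now apply Cmod_add_sqr_le.
- apply (@ex_series_scal R_AbsRing R_NormedModule); apply ell2_summable.
- apply (@ex_series_scal R_AbsRing R_NormedModule); apply ell2_summable.
Qed.

Lemma ell2_norm_scal (c : C) (f : ell2) :
  ell2_norm (ell2_scal c f) = Cmod c * ell2_norm f.
Proof.
unfold ell2_norm.
rewrite (Series_ext _ (fun n => Cmod c ^ 2 * Cmod (f n) ^ 2)).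
- rewrite Series_scal_l, sqrt_mult_alt by apply pow2_ge_0.
  now rewrite sqrt_pow2 by apply Cmod_ge_0.
- intros n; simpl; rewrite Cmod_mult; ring.
Qed.

Definition ell2_ball (f : ell2) (eps : R) (g : ell2) : Prop :=
  ell2_norm (minus g f) < eps.

Definition ell2_UniformSpace_mixin : UniformSpace.mixin_of ell2.
Proof.
apply (UniformSpace.Mixin ell2 ell2_zero ell2_ball); unfold ell2_ball.
- intros f e.
  replace (minus f f) with (ell2_scal (RtoC 0) f)
    by (apply ell2_eq; intros n; simpl; ring).
  rewrite ell2_norm_scal, Cmod_0; generalize (cond_pos e); lra.
- intros f g e.
  replace (minus f g) with (ell2_scal (- RtoC 1)%C (minus g f))
    by (apply ell2_eq; intros n; simpl; ring).
  rewrite ell2_norm_scal, Cmod_opp, Cmod_1; lra.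
- intros f g h e1 e2 H1 H2.
  replace (minus h f) with (ell2_plus (minus g f) (minus h g))
    by (apply ell2_eq; intros n; simpl; ring).
  generalize (ell2_norm_triangle (minus g f) (minus h g)); lra.
Defined.

Canonical ell2_UniformSpace :=
  UniformSpace.Pack ell2 ell2_UniformSpace_mixin ell2.

Canonical ell2_NormedModuleAux :=
  NormedModuleAux.Pack C_AbsRing ell2
    (NormedModuleAux.Class C_AbsRing _
       (ModuleSpace.class _ ell2_ModuleSpace) ell2_UniformSpace_mixin) ell2.

Definition ell2_NormedModule_mixin :
  NormedModule.mixin_of C_AbsRing ell2_NormedModuleAux.
Proof.
apply (NormedModule.Mixin C_AbsRing ell2_NormedModuleAux ell2_norm 1).
- exact ell2_norm_triangle.
- intros c f; right; apply ell2_norm_scal.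
- intros f g e H; exact H.
- intros f g e H; rewrite Rmult_1_l; exact H.
- exact ell2_norm_eq0.
Defined.

Canonical ell2_NormedModule :=
  NormedModule.Pack C_AbsRing ell2
    (NormedModule.Class _ _ _ ell2_NormedModule_mixin) ell2.

(** Both series converge absolutely for [f] and [g] in [ell2]; the inner
    product is linear in the first argument. *)
Definition inner (f g : ell2) : C :=
  (Series (fun n => Re (f n * Cconj (g n))%C),
   Series (fun n => Im (f n * Cconj (g n))%C)).

Definition ebasis (m : nat) : ell2 :=
  Ell2 (fun n => if Nat.eqb n m then RtoC 1 else RtoC 0)
       (single_summable (RtoC 1) m).

Definition Cnonneg (z : C) : Prop := 0 <= Re z /\ Im z = 0.

(** Coquelicot's [is_linear] includes boundedness. *)

Definition compact_operator (T : ell2 -> ell2) : Prop :=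
  is_linear T /\
  forall f : nat -> ell2,
    (exists M : R, forall k, norm (f k) <= M) ->
    exists phi : nat -> nat, (forall k, (phi k < phi (S k))%nat) /\
    exists g : ell2, filterlim (fun k => T (f (phi k))) eventually (locally g).

Definition is_adjoint (T S : ell2 -> ell2) : Prop :=
  is_linear S /\ forall f g : ell2, inner (T f) g = inner f (S g).

Definition positive_operator (P : ell2 -> ell2) : Prop :=
  is_linear P /\ forall f : ell2, Cnonneg (inner (P f) f).

(** [P] is the absolute value |T|, the positive square root of T^* T. *)
Definition is_absolute_value (T P : ell2 -> ell2) : Prop :=
  positive_operator P /\
  exists S : ell2 -> ell2,
    is_adjoint T S /\ forall f : ell2, P (P f) = S (T f).

(** tr |T| is finite; the trace of a positive operator does not depend on the
    orthonormal basis, and is taken here in the standard one. *)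
Definition trace_class_operator (T : ell2 -> ell2) : Prop :=
  is_linear T /\
  exists P : ell2 -> ell2,
    is_absolute_value T P /\
    ex_series (fun n => Re (inner (P (ebasis n)) (ebasis n))).

Definition imatrix : Type := nat -> nat -> C.

Definition has_matrix (T : ell2 -> ell2) (A : imatrix) : Prop :=
  forall n m : nat, T (ebasis m) n = A n m.

Definition bounded_matrix (A : imatrix) : Prop :=
  exists T : ell2 -> ell2, is_linear T /\ has_matrix T A.

Definition compact_matrix (A : imatrix) : Prop :=
  exists T : ell2 -> ell2, compact_operator T /\ has_matrix T A.

Definition trace_class_matrix (A : imatrix) : Prop :=
  exists T : ell2 -> ell2, trace_class_operator T /\ has_matrix T A.

(** [sum_n u N] is [u 0 + ... + u N], so [N] bounds the support of [f]. *)
Definition positive_semidefinite (A : imatrix) : Prop :=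
  forall (f : nat -> C) (N : nat),
    (forall n, (N < n)%nat -> f n = RtoC 0) ->
    Cnonneg (sum_n (fun n => sum_n (fun m => A n m * f n * Cconj (f m))%C N) N).

Definition formally_rank_one (A : imatrix) : Prop :=
  exists u : nat -> C,
    (exists n, u n <> RtoC 0) /\ forall n m : nat, A n m = (u n * u m)%C.

Definition Amat (q tau rho : R) : imatrix := fun n m =>
  RtoC (Rpower q (tau * INR (Nat.max n m)) /
        Rpower q (tau * INR (n + m) / 2) *
        Rpower q (rho * INR (n + m) / 2)).

(* Main.v *)
Require Import Defs.
From Stdlib Require Import Reals Lra Lia.
From Stdlib Require Import Classical_Prop FunctionalExtensionality.
From Stdlib Require Import IndefiniteDescription.
From Coquelicot Require Import Coquelicot.
Open Scope R_scope.

(** With [a = q ^ (tau / 2)] and [b = q ^ (rho / 2)] the matrix is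
    [a ^ |n - m| * b ^ (n + m)] ([Amat_exp_kernel]): a Toeplitz kernel
    multiplied on both sides by a diagonal one. The three cases of the theorem
    are [a < 1], [a = 1] and [a > 1].

    Whenever [b <= c] and [a * b <= c] for some [c < 1], the entries are bounded
    by [c ^ (n + m)], so that the norms of the columns are summable. This is
    all that boundedness, compactness and the trace class property need
    ([hermitian_summable_rows]). Boundedness follows from the Cauchy-Schwarz
    inequality. For compactness, a diagonal subsequence converges
    coordinatewise, and dominated convergence turns this into convergence in
    norm. For the trace, the diagonal entries of the absolute value satisfy
    [<|T| e_n, e_n> <= norm (|T| e_n) = norm (T e_n)], so only the existence of
    [|T|] is at stake. For a self-adjoint [T] of norm at most [M] it is
    [M (1 - Y)], where [Y] is the limit of the iteration [Y' = (X + Y ^ 2) / 2] with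
    [X = 1 - (T / M) ^ 2] ([selfadjoint_absolute_value]); the same iteration
    on the real number 1 majorizes all increments and gives convergence.

    The case [a < 1], [b = 1] is not covered by decay: the Toeplitz matrix is
    bounded by Schur's test, and it is not compact because the images of the
    basis vectors tend to 0 coordinatewise while their norms are at least 1.
    Positivity for [a < 1] is an induction on the size of the truncation
    ([exp_kernel_psd]). The negative statements on boundedness are read off
    the diagonal [b ^ (2 n)] or the first column [(a b) ^ n]. *)

(** * Series and limits of sequences *)

Lemma sum_n_le_Series (a : nat -> R) (N : nat) :
  (forall n, 0 <= a n) -> ex_series a -> sum_n a N <= Series a.
Proof.
intros Ha Hs.
apply (is_lim_seq_incr_compare (sum_n a)).
- apply Series_correct, Hs.
- intros n; rewrite sum_Sn; unfold plus; simpl; generalize (Ha (S n)); lra.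
Qed.

Lemma term_le_Series (a : nat -> R) (n : nat) :
  (forall n, 0 <= a n) -> ex_series a -> a n <= Series a.
Proof.
intros Ha Hs; apply Rle_trans with (sum_n a n); [|now apply sum_n_le_Series].
destruct n as [|n].
- rewrite sum_O; apply Rle_refl.
- rewrite sum_Sn; unfold plus; simpl.
  assert (0 <= sum_n a n); [|lra].
  rewrite sum_n_Reals; now apply cond_pos_sum.
Qed.

Lemma Series_nonneg (a : nat -> R) :
  (forall n, 0 <= a n) -> ex_series a -> 0 <= Series a.
Proof.
intros Ha Hs; apply Rle_trans with (sum_n a 0).
- rewrite sum_O; apply Ha.
- now apply sum_n_le_Series.
Qed.

Lemma Series_bounded (a : nat -> R) (B : R) :
  (forall n, 0 <= a n) -> (forall N, sum_n a N <= B) ->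
  ex_series a /\ Series a <= B.
Proof.
intros Ha HB.
assert (Hs : ex_series a).
{ apply ex_finite_lim_seq_incr with B; [|exact HB].
  intros n; rewrite sum_Sn; unfold plus; simpl; generalize (Ha (S n)); lra. }
split; [exact Hs|].
apply (is_lim_seq_le (sum_n a) (fun _ => B) (Series a) B HB).
- apply Series_correct, Hs.
- apply is_lim_seq_const.
Qed.

Lemma is_lim_seq_sum_n (x : nat -> nat -> R) (l : nat -> R) (N : nat) :
  (forall n, is_lim_seq (fun k => x k n) (l n)) ->
  is_lim_seq (fun k => sum_n (x k) N) (sum_n l N).
Proof.
intros H; induction N as [|N IH].
- apply is_lim_seq_ext with (fun k => x k 0%nat).
  + intros k; now rewrite sum_O.
  + rewrite sum_O; apply H.
- apply is_lim_seq_ext with (fun k => sum_n (x k) N + x k (S N)).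
  + intros k; now rewrite sum_Sn.
  + rewrite sum_Sn; now apply is_lim_seq_plus'.
Qed.

Lemma is_lim_seq_squeeze0 (u v : nat -> R) :
  (forall k, Rabs (u k) <= v k) -> is_lim_seq v 0 -> is_lim_seq u 0.
Proof.
intros H Hv; apply is_lim_seq_abs_0.
apply (is_lim_seq_le_le (fun _ => 0) _ v); [|apply is_lim_seq_const|exact Hv].
intros k; split; [apply Rabs_pos|apply H].
Qed.

Lemma is_lim_seq_minus0 (u : nat -> R) (l : R) :
  is_lim_seq (fun k => u k - l) 0 -> is_lim_seq u l.
Proof.
intros H; apply is_lim_seq_ext with (fun k => (u k - l) + l).
- intros k; ring.
- replace (Finite l) with (Finite (0 + l)) by (f_equal; ring).
  apply is_lim_seq_plus'; [exact H|apply is_lim_seq_const].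
Qed.

(** Dominated convergence for series: beyond a fixed index the tails are
    uniformly small, and below it there are finitely many terms. *)
Lemma Series_dominated_lim0 (x : nat -> nat -> R) (D : nat -> R) :
  (forall k n, 0 <= x k n <= D n) -> ex_series D ->
  (forall n, is_lim_seq (fun k => x k n) 0) ->
  is_lim_seq (fun k => Series (x k)) 0.
Proof.
intros Hx HD Hl.
assert (Hex : forall k, ex_series (x k)).
{ intros k; apply (@ex_series_le R_AbsRing R_CompleteNormedModule _ D);
    [|exact HD].
  intros n; change (Rabs (x k n) <= D n); rewrite Rabs_pos_eq; apply Hx. }
apply is_lim_seq_spec; intros eps.
assert (Htail : is_lim_seq (sum_n D) (Series D)) by apply Series_correct, HD.
apply is_lim_seq_spec in Htail.
destruct (Htail (pos_div_2 eps)) as [N HN].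
specialize (HN N (Nat.le_refl N)); simpl in HN.
assert (HF := is_lim_seq_sum_n x (fun _ => 0) N Hl).
rewrite sum_n_const, Rmult_0_r in HF.
apply is_lim_seq_spec in HF.
destruct (HF (pos_div_2 eps)) as [K HK]; exists K; intros k hk.
specialize (HK k hk); simpl in HK; rewrite Rminus_0_r in *.
assert (E1 := Series_incr_n (x k) (S N) (Nat.lt_0_succ N) (Hex k)).
assert (E2 := Series_incr_n D (S N) (Nat.lt_0_succ N) HD).
simpl Init.Nat.pred in *; rewrite <- sum_n_Reals in *.
assert (Hle : Series (fun j => x k (S N + j)%nat) <=
              Series (fun j => D (S N + j)%nat)).
{ apply Series_le; [intros j; apply Hx|now apply ex_series_incr_n]. }
change (Rabs (sum_n D N - Series D) < eps / 2) in HN.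
apply Rabs_def2 in HN; apply Rabs_def2 in HK.
assert (P := Series_nonneg (x k) (fun n => proj1 (Hx k n)) (Hex k)).
rewrite Rabs_pos_eq by exact P; lra.
Qed.

(** * The inner product of ell2 *)

Definition rinner (f g : ell2) : R := Series (fun n => Re (f n * Cconj (g n))%C).

Lemma rinner_summable (f g : ell2) :
  ex_series (fun n => Re (f n * Cconj (g n))%C).
Proof.
apply (@ex_series_le R_AbsRing R_CompleteNormedModule _
         (fun n => 1 * Cmod (f n) ^ 2 + 1 * Cmod (g n) ^ 2));
  [|apply summable_comb].
intros n; change (Rabs (Re (f n * Cconj (g n))%C) <=
                  1 * Cmod (f n) ^ 2 + 1 * Cmod (g n) ^ 2).
rewrite !Cmod2_alt; destruct (f n) as [a b], (g n) as [c d]; simpl.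
apply Rabs_le; split.
- generalize (pow2_ge_0 (a + c)) (pow2_ge_0 (b + d)); nra.
- generalize (pow2_ge_0 (a - c)) (pow2_ge_0 (b - d)); nra.
Qed.

Lemma rinner_sym (f g : ell2) : rinner f g = rinner g f.
Proof.
apply Series_ext; intros n; destruct (f n), (g n); simpl; ring.
Qed.

Lemma rinner_plus_l (f g h : ell2) :
  rinner (plus f g) h = rinner f h + rinner g h.
Proof.
unfold rinner; rewrite <- Series_plus by apply rinner_summable.
apply Series_ext; intros n; simpl; destruct (f n), (g n), (h n); simpl; ring.
Qed.

Lemma rinner_scal_l (t : R) (f g : ell2) :
  rinner (scal (RtoC t) f) g = t * rinner f g.
Proof.
unfold rinner; rewrite <- Series_scal_l.
apply Series_ext; intros n; simpl; destruct (f n), (g n); simpl; ring.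
Qed.

Lemma rinner_plus_r (f g h : ell2) :
  rinner f (plus g h) = rinner f g + rinner f h.
Proof. now rewrite rinner_sym, rinner_plus_l, !(rinner_sym f). Qed.

Lemma rinner_scal_r (t : R) (f g : ell2) :
  rinner f (scal (RtoC t) g) = t * rinner f g.
Proof. now rewrite rinner_sym, rinner_scal_l, rinner_sym. Qed.

Lemma rinner_minus_l (f g h : ell2) :
  rinner (minus f g) h = rinner f h - rinner g h.
Proof.
replace (minus f g) with (plus f (scal (RtoC (-1)) g)).
- rewrite rinner_plus_l, rinner_scal_l; ring.
- apply ell2_eq; intros n; simpl; destruct (f n), (g n).
  apply injective_projections; simpl; ring.
Qed.

Lemma rinner_Ci_l (f g : ell2) :
  rinner (scal Ci f) g = - rinner f (scal Ci g).
Proof.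
unfold rinner; rewrite <- Series_opp.
apply Series_ext; intros n; simpl; destruct (f n), (g n); simpl; ring.
Qed.

Lemma rinner_self (f : ell2) : rinner f f = norm f ^ 2.
Proof.
change (norm f) with (ell2_norm f); rewrite ell2_norm_sqr.
apply Series_ext; intros n; rewrite Cmod2_alt; destruct (f n); simpl; ring.
Qed.

(** The imaginary part of the complex inner product is the real inner product
    with a rotated vector, so that facts about [inner] reduce to facts about
    the real bilinear form [rinner]. *)
Lemma inner_rinner (f g : ell2) :
  inner f g = (rinner f g, rinner f (scal Ci g)).
Proof.
unfold inner; f_equal.
apply Series_ext; intros n; simpl; destruct (f n), (g n); simpl; ring.
Qed.

Lemma inner_plus_l (f g h : ell2) :
  inner (plus f g) h = (inner f h + inner g h)%C.
Proof. now rewrite !inner_rinner, !rinner_plus_l. Qed.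

Lemma inner_scal_l (c : C) (f g : ell2) :
  inner (scal c f) g = (c * inner f g)%C.
Proof.
assert (H : forall h, rinner (scal c f) h =
                      Re c * rinner f h - Im c * rinner f (scal Ci h)).
{ intros h; destruct c as [x y]; simpl Re; simpl Im.
  replace (scal ((x, y) : C) f) with (plus (scal (RtoC x) f)
                                  (scal (RtoC y) (scal Ci f))).
  - rewrite rinner_plus_l, !rinner_scal_l, rinner_Ci_l; ring.
  - apply ell2_eq; intros n; simpl; destruct (f n).
    apply injective_projections; simpl; ring. }
rewrite !inner_rinner, !H.
replace (scal Ci (scal Ci g)) with (scal (RtoC (-1)) g).
- rewrite (rinner_sym f (scal (RtoC (-1)) g)), rinner_scal_l, (rinner_sym g f).
  destruct c; apply injective_projections; simpl; ring.
- apply ell2_eq; intros n; simpl; destruct (g n).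
  apply injective_projections; simpl; ring.
Qed.

Lemma inner_conj (f g : ell2) : inner g f = Cconj (inner f g).
Proof.
rewrite !inner_rinner, (rinner_sym g f), (rinner_sym g), rinner_Ci_l.
reflexivity.
Qed.

Lemma norm_plus_sqr (f g : ell2) :
  norm (plus f g) ^ 2 = norm f ^ 2 + 2 * rinner f g + norm g ^ 2.
Proof.
rewrite <- !rinner_self, rinner_plus_l, (rinner_sym f (plus f g)),
  (rinner_sym g (plus f g)), !rinner_plus_l, (rinner_sym g f); ring.
Qed.

Lemma norm_scal_ell2 (c : C) (f : ell2) : norm (scal c f) = Cmod c * norm f.
Proof. exact (ell2_norm_scal c f). Qed.

Lemma norm_zero_ell2 : norm (@zero ell2_AbelianMonoid) = 0.
Proof. exact (@norm_zero C_AbsRing ell2_NormedModule). Qed.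

Lemma norm_plus_le (f g : ell2) : norm (plus f g) <= norm f + norm g.
Proof. exact (ell2_norm_triangle f g). Qed.

Lemma norm_half_plus (f g : ell2) :
  norm (scal (RtoC (/ 2)) (plus f g)) <= / 2 * (norm f + norm g).
Proof.
rewrite norm_scal_ell2, Cmod_R, Rabs_pos_eq by lra.
apply Rmult_le_compat_l; [lra|apply norm_plus_le].
Qed.

Lemma rinner_cauchy_schwarz (f g : ell2) :
  Rabs (rinner f g) <= norm f * norm g.
Proof.
assert (hf := norm_ge_0 f); assert (hg := norm_ge_0 g).
assert (H : rinner f g ^ 2 <= (norm f * norm g) ^ 2).
{ destruct hg as [hg|hg].
  - assert (H := pow2_ge_0 (norm (plus (scal (RtoC (norm g ^ 2)) f)
                             (scal (RtoC (- rinner f g)) g)))).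
    rewrite norm_plus_sqr, !norm_scal_ell2, !Cmod_R, rinner_scal_l,
      rinner_sym, rinner_scal_l, (rinner_sym g f), !Rpow_mult_distr,
      !pow2_abs in H.
    apply Rmult_le_reg_l with (norm g ^ 2); [nra|].
    nra.
  - rewrite (ell2_norm_eq0 g) by (symmetry; exact hg).
    replace ell2_zero with (scal (RtoC 0) f)
      by (apply ell2_eq; intros n; simpl; ring).
    rewrite rinner_sym, rinner_scal_l; nra. }
rewrite <- (Rabs_pos_eq (norm f * norm g)) by nra.
apply Rsqr_le_abs_0; rewrite !Rsqr_pow2; exact H.
Qed.

(** Rotating [f] by the conjugate of the inner product makes the latter real,
    which reduces the complex inequality to the real one. *)
Lemma inner_cauchy_schwarz (f g : ell2) :
  Cmod (inner f g) <= norm f * norm g.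
Proof.
set (z := inner f g).
assert (H : Cmod z ^ 2 <= Cmod z * (norm f * norm g)).
{ assert (E : rinner (scal (Cconj z) f) g = Cmod z ^ 2).
  { assert (E := inner_scal_l (Cconj z) f g).
    rewrite inner_rinner in E; apply (f_equal Re) in E; simpl in E.
    rewrite Cmod2_alt, E; fold z; simpl; ring. }
  assert (H := rinner_cauchy_schwarz (scal (Cconj z) f) g).
  rewrite E, norm_scal_ell2, Cmod_conj in H.
  generalize (Rle_abs (Cmod z ^ 2)); nra. }
destruct (Cmod_ge_0 z) as [h|h].
- apply Rmult_le_reg_l with (Cmod z); nra.
- rewrite <- h; generalize (norm_ge_0 f) (norm_ge_0 g); nra.
Qed.

Lemma ell2_Cmod_le_norm (f : ell2) (n : nat) : Cmod (f n) <= norm f.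
Proof. exact (ell2_coord_le f n). Qed.

Lemma norm_sqr_Series (f : ell2) :
  norm f ^ 2 = Series (fun n => Cmod (f n) ^ 2).
Proof. exact (ell2_norm_sqr f). Qed.

Lemma inner_ebasis_l (m : nat) (g : ell2) : inner (ebasis m) g = Cconj (g m).
Proof.
assert (H : forall h : ell2, rinner (ebasis m) h = Re (h m)).
{ intros h; apply is_series_unique.
  assert (V : forall n, Re (ebasis m n * Cconj (h n))%C =
                        if Nat.eqb n m then Re (h n) else 0).
  { intros n; unfold ebasis, ell2_val at 1.
    destruct (Nat.eqb n m); simpl; destruct (h n); simpl; ring. }
  assert (L : forall N, sum_n (fun n => Re (ebasis m n * Cconj (h n))%C) N =
                        if Nat.leb m N then Re (h m) else 0).
  { induction N as [|N IH].
    - rewrite sum_O, V; now destruct m as [|m].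
    - rewrite sum_Sn, IH, V; change plus with Rplus.
      destruct (Nat.leb_spec m N), (Nat.leb_spec m (S N)),
        (Nat.eqb_spec (S N) m); subst; try lia; simpl; rewrite ?Rplus_0_l, ?Rplus_0_r; reflexivity. }
  apply filterlim_ext_loc with (fun _ => Re (h m)).
  - exists m; intros N hN; symmetry; etransitivity; [apply L|].
    now rewrite (proj2 (Nat.leb_le m N) hN).
  - apply filterlim_const. }
rewrite inner_rinner, !H; simpl; destruct (g m); simpl.
apply injective_projections; simpl; ring.
Qed.

Lemma norm_ebasis (m : nat) : norm (ebasis m) = 1.
Proof.
assert (E : norm (ebasis m) ^ 2 = 1).
{ rewrite <- rinner_self.
  change (rinner (ebasis m) (ebasis m)) with (Re (inner (ebasis m) (ebasis m))).
  rewrite inner_ebasis_l; simpl; rewrite Nat.eqb_refl; reflexivity. }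
assert (h := norm_ge_0 (ebasis m)); nra.
Qed.

(** * Convergence and completeness in ell2 *)

Lemma ell2_lim_norm (u : nat -> ell2) (f : ell2) :
  filterlim u eventually (locally f) <->
  is_lim_seq (fun k => norm (minus (u k) f)) 0.
Proof.
split.
- intros H; apply is_lim_seq_spec; intros eps.
  destruct (proj1 (filterlim_locally_ball_norm u f) H eps) as [N HN].
  exists N; intros k hk; rewrite Rminus_0_r, Rabs_pos_eq by apply norm_ge_0.
  apply (HN k hk).
- intros H; apply (proj2 (filterlim_locally_ball_norm u f)); intros eps.
  apply is_lim_seq_spec in H; destruct (H eps) as [N HN].
  exists N; intros k hk; specialize (HN k hk); simpl in HN.
  rewrite Rminus_0_r, Rabs_pos_eq in HN by apply norm_ge_0; exact HN.
Qed.

Lemma rinner_lim (u : nat -> ell2) (f g : ell2) :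
  filterlim u eventually (locally f) ->
  is_lim_seq (fun k => rinner (u k) g) (rinner f g).
Proof.
intros H; apply is_lim_seq_minus0.
apply is_lim_seq_squeeze0 with (fun k => norm (minus (u k) f) * norm g).
- intros k; rewrite <- rinner_minus_l; apply rinner_cauchy_schwarz.
- replace 0 with (0 * norm g) by ring.
  apply (is_lim_seq_scal_r _ (norm g) 0).
  now apply ell2_lim_norm.
Qed.

Lemma Cmod_minus_lim0 (z : nat -> C) (a b : R) :
  is_lim_seq (fun k => Re (z k)) a -> is_lim_seq (fun k => Im (z k)) b ->
  is_lim_seq (fun k => Cmod (z k - (a, b))%C) 0.
Proof.
intros Ha Hb.
apply is_lim_seq_squeeze0
  with (fun k => Rabs (Re (z k) - a) + Rabs (Im (z k) - b)).
- intros k; rewrite Rabs_pos_eq by apply Cmod_ge_0.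
  destruct (z k) as [x y]; simpl.
  replace ((x, y) - (a, b))%C with
    (RtoC (x - a) + Ci * RtoC (y - b))%C
    by (apply injective_projections; simpl; ring).
  eapply Rle_trans; [apply Cmod_triangle|].
  rewrite Cmod_mult, !Cmod_R.
  replace (Cmod Ci) with 1; [lra|].
  rewrite <- sqrt_1 at 1; unfold Cmod; f_equal; simpl; ring.
- replace 0 with (0 + 0) by ring; apply is_lim_seq_plus';
    apply (is_lim_seq_abs_0 (fun k => _ - _)).
  + replace 0 with (a - a) by ring.
    apply is_lim_seq_minus'; [exact Ha|apply is_lim_seq_const].
  + replace 0 with (b - b) by ring.
    apply is_lim_seq_minus'; [exact Hb|apply is_lim_seq_const].
Qed.

Lemma Im_le_Cmod (z : C) : Rabs (Im z) <= Cmod z.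
Proof.
rewrite <- (Rabs_pos_eq (Cmod z)) by apply Cmod_ge_0.
apply Rsqr_le_abs_0; rewrite !Rsqr_pow2, Cmod2_alt.
generalize (pow2_ge_0 (Re z)); lra.
Qed.

Lemma C_complete (z : nat -> C) (e : nat -> R) :
  (forall k j, (k <= j)%nat -> Cmod (z j - z k)%C <= e k) -> is_lim_seq e 0 ->
  exists l, is_lim_seq (fun k => Cmod (z k - l)%C) 0.
Proof.
intros Hz He.
assert (Hc : forall p : C -> R, (forall x y, p (x - y)%C = p x - p y) ->
               (forall x, Rabs (p x) <= Cmod x) ->
               ex_finite_lim_seq (fun k => p (z k))).
{ intros p Hp Hb; apply ex_lim_seq_cauchy_corr; intros eps.
  apply is_lim_seq_spec in He; destruct (He (pos_div_2 eps)) as [N HN].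
  specialize (HN N (Nat.le_refl N)); simpl in HN; rewrite Rminus_0_r in HN.
  apply Rabs_def2 in HN.
  assert (HpN : forall n, (N <= n)%nat -> Rabs (p (z n) - p (z N)) <= e N).
  { intros n hn; rewrite <- Hp; eapply Rle_trans; [apply Hb|now apply Hz]. }
  exists N; intros n m hn hm.
  assert (H1 := HpN n hn); assert (H2 := HpN m hm).
  apply Rabs_le_between in H1; apply Rabs_le_between in H2.
  apply Rabs_def1; lra. }
destruct (Hc Re) as [a Ha]; [reflexivity|apply re_le_Cmod|].
destruct (Hc Im) as [b Hb]; [reflexivity|apply Im_le_Cmod|].
exists (a, b); now apply Cmod_minus_lim0.
Qed.

(** Fatou: the partial sums of the squared coordinates of the limit are limits
    of partial sums bounded by [B ^ 2]. *)
Lemma ell2_fatou (u : nat -> ell2) (v : nat -> C) (B : R) :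
  (forall k, norm (u k) <= B) ->
  (forall n, is_lim_seq (fun k => Cmod (u k n - v n)%C) 0) ->
  exists g : ell2, (forall n, g n = v n) /\ norm g <= B.
Proof.
intros HB Hv.
assert (hB : 0 <= B).
{ apply Rle_trans with (norm (u 0%nat)); [apply norm_ge_0|apply HB]. }
assert (Hl : forall n, is_lim_seq (fun k => Cmod (u k n) ^ 2) (Cmod (v n) ^ 2)).
{ intros n.
  assert (L : is_lim_seq (fun k => Cmod (u k n)) (Cmod (v n))).
  { apply is_lim_seq_minus0.
    apply is_lim_seq_squeeze0 with (2 := Hv n).
    intros k; apply Rabs_le.
    assert (H1 := Cmod_triangle (u k n - v n)%C (v n)).
    assert (H2 := Cmod_triangle (- (u k n - v n))%C (u k n)).
    rewrite Cmod_opp in H2.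
    replace (u k n - v n + v n)%C with (u k n) in H1 by ring.
    replace (- (u k n - v n) + u k n)%C with (v n) in H2 by ring.
    lra. }
  simpl; apply is_lim_seq_mult'; [exact L|].
  apply is_lim_seq_mult'; [exact L|apply is_lim_seq_const]. }
destruct (Series_bounded (fun n => Cmod (v n) ^ 2) (B ^ 2)) as [Hs Hle].
- intros n; apply pow2_ge_0.
- intros N.
  apply (is_lim_seq_le (fun k => sum_n (fun n => Cmod (u k n) ^ 2) N)
           (fun _ => B ^ 2) (sum_n (fun n => Cmod (v n) ^ 2) N) (B ^ 2)).
  + intros k; apply Rle_trans with (norm (u k) ^ 2).
    * rewrite norm_sqr_Series; apply (sum_n_le_Series (fun n => Cmod (u k n) ^ 2)).
      -- intros n; apply pow2_ge_0.
      -- apply ell2_summable.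
    * apply pow_incr; split; [apply norm_ge_0|apply HB].
  + now apply (is_lim_seq_sum_n (fun k n => Cmod (u k n) ^ 2)).
  + apply is_lim_seq_const.
- exists (Ell2 v Hs); split; [reflexivity|].
  apply Rsqr_incr_0_var; [rewrite !Rsqr_pow2|exact hB].
  rewrite norm_sqr_Series; exact Hle.
Qed.

(** The coordinates converge, and [ell2_fatou] passes the Cauchy estimate to
    the limit. *)
Lemma ell2_complete (u : nat -> ell2) (e : nat -> R) :
  (forall k j, (k <= j)%nat -> norm (minus (u j) (u k)) <= e k) ->
  is_lim_seq e 0 ->
  exists g : ell2, forall k, norm (minus g (u k)) <= e k.
Proof.
intros Hu He.
destruct (functional_choice
            (fun n l => is_lim_seq (fun k => Cmod (u k n - l)%C) 0)) as [v Hv].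
{ intros n; apply C_complete with e; [|exact He].
  intros k j hkj; eapply Rle_trans; [|exact (Hu k j hkj)].
  exact (ell2_Cmod_le_norm (minus (u j) (u k)) n). }
assert (H : forall k, exists g : ell2,
          (forall n, g n = (v n - u k n)%C) /\ norm g <= e k).
{ intros k; apply (ell2_fatou (fun j => minus (u (j + k)%nat) (u k))).
  - intros j; apply Hu; lia.
  - intros n; 
    apply is_lim_seq_ext with (fun j => Cmod (u (j + k)%nat n - v n)%C).
    + intros j; f_equal; simpl; ring.
    + apply (is_lim_seq_incr_n (fun j => Cmod (u j n - v n)%C)), Hv. }
destruct (H 0%nat) as [g0 [Hg0 _]].
exists (plus g0 (u 0%nat)); intros k; destruct (H k) as [g [Hg Hn]].
replace (minus (plus g0 (u 0%nat)) (u k)) with g; [exact Hn|].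
apply ell2_eq; intros n; simpl; rewrite Hg, Hg0; ring.
Qed.

Lemma sum_ebasis_coord (f : ell2) (N n : nat) :
  sum_n (fun m => scal (f m) (ebasis m)) N n =
  if Nat.leb n N then f n else RtoC 0.
Proof.
induction N as [|N IH].
- rewrite sum_O; simpl; destruct n as [|n]; simpl; ring.
- rewrite sum_Sn.
  change (plus (sum_n (fun m => scal (f m) (ebasis m)) N)
            (scal (f (S N)) (ebasis (S N))) n)
    with (sum_n (fun m => scal (f m) (ebasis m)) N n +
          f (S N) * (if Nat.eqb n (S N) then 1 else 0))%C.
  rewrite IH.
  destruct (Nat.leb_spec n N), (Nat.leb_spec n (S N)), (Nat.eqb_spec n (S N));
    subst; try lia; ring.
Qed.

Lemma ell2_basis_expansion (f : ell2) :
  is_series (fun m => scal (f m) (ebasis m)) f.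
Proof.
apply ell2_lim_norm.
assert (H : is_lim_seq (fun k => norm (minus
              (sum_n (fun m => scal (f m) (ebasis m)) k) f) ^ 2) 0).
{ apply is_lim_seq_ext with (fun k => Series (fun n =>
    if Nat.leb n k then 0 else Cmod (f n) ^ 2)).
  { intros k; rewrite norm_sqr_Series; apply Series_ext; intros n.
    change (minus (sum_n (fun m => scal (f m) (ebasis m)) k) f n)
      with (sum_n (fun m => scal (f m) (ebasis m)) k n + - f n)%C.
    rewrite sum_ebasis_coord; destruct (Nat.leb n k).
    - replace (f n + - f n)%C with (RtoC 0) by ring; rewrite Cmod_0; ring.
    - replace (0 + - f n)%C with (- f n)%C by ring; now rewrite Cmod_opp. }
  apply Series_dominated_lim0 with (fun n => Cmod (f n) ^ 2).
  - intros k n; assert (h := pow2_ge_0 (Cmod (f n))).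
    destruct (Nat.leb n k); lra.
  - apply ell2_summable.
  - intros n; apply is_lim_seq_ext_loc with (fun _ => 0);
      [|apply is_lim_seq_const].
    exists n; intros k hk; now rewrite (proj2 (Nat.leb_le n k) hk). }
apply is_lim_seq_ext with (fun k => sqrt (norm (minus
              (sum_n (fun m => scal (f m) (ebasis m)) k) f) ^ 2)).
- intros k; apply sqrt_pow2, norm_ge_0.
- rewrite <- sqrt_0; apply (is_lim_seq_continuous sqrt); [|exact H].
  apply continuity_pt_sqrt; lra.
Qed.

Definition rselfadjoint (T : ell2 -> ell2) : Prop :=
  forall f g, rinner (T f) g = rinner f (T g).

(** Both sides of the symmetry relation are continuous in [f], so finite
    combinations of basis vectors suffice. *)
Lemma rselfadjoint_from_basis (T : ell2 -> ell2) :
  is_linear T ->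
  (forall c m g, rinner (T (scal c (ebasis m))) g =
                 rinner (scal c (ebasis m)) (T g)) ->
  rselfadjoint T.
Proof.
intros HT HB f g.
set (u := sum_n (fun m => scal (f m) (ebasis m))).
assert (Hu : filterlim u eventually (locally f)) by apply ell2_basis_expansion.
assert (E : forall N, rinner (T (u N)) g = rinner (u N) (T g)).
{ induction N as [|N IH]; unfold u.
  - rewrite sum_O; apply HB.
  - rewrite sum_Sn, (linear_plus _ HT), !rinner_plus_l.
    f_equal; [exact IH|apply HB]. }
assert (H1 : is_lim_seq (fun N => rinner (u N) (T g)) (rinner (T f) g)).
{ apply is_lim_seq_ext with (fun N => rinner (T (u N)) g); [exact E|].
  apply rinner_lim.
  apply filterlim_comp with (1 := Hu); apply (linear_cont T f HT). }
assert (H2 := rinner_lim u f (T g) Hu).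
apply is_lim_seq_unique in H1; apply is_lim_seq_unique in H2.
rewrite H1 in H2; now injection H2.
Qed.

Lemma is_linear_add (A B : ell2 -> ell2) :
  is_linear A -> is_linear B -> is_linear (fun f => plus (A f) (B f)).
Proof.
intros HA HB.
exact (is_linear_comp (fun f => (A f, B f)) (fun p => plus (fst p) (snd p))
         (is_linear_prod A B HA HB) is_linear_plus).
Qed.

Lemma is_linear_scale (c : C) (A : ell2 -> ell2) :
  is_linear A -> is_linear (fun f => scal c (A f)).
Proof.
intros HA.
exact (is_linear_comp A _ HA
         (@is_linear_scal_r C_AbsRing ell2_NormedModule c Cmult_comm)).
Qed.

Lemma ell2_lim_plus (u v : nat -> ell2) (f g : ell2) :
  filterlim u eventually (locally f) -> filterlim v eventually (locally g) ->
  filterlim (fun k => plus (u k) (v k)) eventually (locally (plus f g)).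
Proof.
intros Hu Hv; exact (filterlim_comp_2 u v plus Hu Hv
         (@filterlim_plus C_AbsRing ell2_NormedModule f g)).
Qed.

Lemma ell2_lim_scal (c : C) (u : nat -> ell2) (f : ell2) :
  filterlim u eventually (locally f) ->
  filterlim (fun k => scal c (u k)) eventually (locally (scal c f)).
Proof.
intros Hu; exact (filterlim_comp _ _ _ _ _ _ _ _ Hu
                    (@filterlim_scal_r C_AbsRing ell2_NormedModule c f)).
Qed.

(** * Square roots and absolute values of self-adjoint operators *)

Fixpoint sqrt_iter (X : ell2 -> ell2) (k : nat) (f : ell2) : ell2 :=
  match k with
  | 0%nat => zero
  | S k => scal (RtoC (/ 2)) (plus (X f) (sqrt_iter X k (sqrt_iter X k f)))
  end.

(** The scalar iteration for [X = 1]; it majorizes [sqrt_iter] in norm. *)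
Fixpoint sqrt_iter_bound (k : nat) : R :=
  match k with
  | 0%nat => 0
  | S k => / 2 * (1 + sqrt_iter_bound k ^ 2)
  end.

Lemma sqrt_iter_bound_itv (k : nat) : 0 <= sqrt_iter_bound k <= 1.
Proof.
induction k as [|k IH]; simpl; [lra|].
set (y := sqrt_iter_bound k) in *; nra.
Qed.

Lemma sqrt_iter_bound_incr (k j : nat) :
  (k <= j)%nat -> sqrt_iter_bound k <= sqrt_iter_bound j.
Proof.
induction 1 as [|j _ IH]; [lra|]; apply Rle_trans with (1 := IH).
simpl; set (y := sqrt_iter_bound j); generalize (pow2_ge_0 (1 - y)); nra.
Qed.

(** The defect [z = 1 - y] obeys [z' = z - z ^ 2 / 2], a map increasing on
    [0, 1] that sends [2 / (k + 2)] below [2 / (k + 3)]. *)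
Lemma sqrt_iter_bound_rate (k : nat) :
  1 - sqrt_iter_bound k <= 2 * / (INR k + 2).
Proof.
induction k as [|k IH]; [simpl; lra|].
assert (hy := sqrt_iter_bound_itv k); rewrite S_INR.
assert (hk := pos_INR k).
change (sqrt_iter_bound (S k)) with (/ 2 * (1 + sqrt_iter_bound k ^ 2)).
set (y := sqrt_iter_bound k) in *.
set (w := 2 * / (INR k + 2)) in *.
assert (hw : 0 < w <= 1).
{ unfold w; split.
  - apply Rmult_lt_0_compat; [lra|apply Rinv_0_lt_compat; lra].
  - apply Rmult_le_reg_r with (INR k + 2); [lra|].
    rewrite Rmult_assoc, Rinv_l; lra. }
apply Rle_trans with (w - w ^ 2 / 2).
- replace (1 - / 2 * (1 + y ^ 2)) with ((1 - y) - (1 - y) ^ 2 / 2) by field.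
  assert (0 <= (w - (1 - y)) * (2 - w - (1 - y))); [|nra].
  apply Rmult_le_pos; lra.
- assert (E : 2 * / (INR k + 1 + 2) - (w - w ^ 2 / 2) =
              2 * / (INR k + 3) * / (INR k + 2) ^ 2).
  { unfold w; field; lra. }
  assert (0 < 2 * / (INR k + 3) * / (INR k + 2) ^ 2); [|lra].
  apply Rmult_lt_0_compat; [apply Rmult_lt_0_compat; [lra|]|];
    apply Rinv_0_lt_compat; [lra|apply pow_lt; lra].
Qed.

Lemma sqrt_iter_bound_lim (c : R) :
  0 <= c -> is_lim_seq (fun k => (1 - sqrt_iter_bound k) * c) 0.
Proof.
intros hc; apply is_lim_seq_squeeze0 with (fun k => 2 * / (INR k + 2) * c).
- intros k; assert (h := sqrt_iter_bound_itv k).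
  rewrite Rabs_pos_eq by (apply Rmult_le_pos; lra).
  apply Rmult_le_compat_r; [exact hc|apply sqrt_iter_bound_rate].
- replace 0 with (2 * 0 * c) by ring.
  apply is_lim_seq_mult'; [|apply is_lim_seq_const].
  apply is_lim_seq_mult'; [apply is_lim_seq_const|].
  apply (is_lim_seq_inv (fun k => INR k + 2) p_infty); [|easy].
  eapply is_lim_seq_plus; [apply is_lim_seq_INR|apply is_lim_seq_const|easy].
Qed.

Section SquareRoot.

Variable X : ell2 -> ell2.
Hypothesis HX : is_linear X.
Hypothesis HXs : rselfadjoint X.
Hypothesis HX1 : forall f, norm (X f) <= norm f.

Lemma sqrt_iter_linear (k : nat) : is_linear (sqrt_iter X k).
Proof.
induction k as [|k IH]; simpl.
- exact (@is_linear_zero C_AbsRing ell2_NormedModule ell2_NormedModule).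
- apply is_linear_scale, is_linear_add; [exact HX|].
  exact (is_linear_comp _ _ IH IH).
Qed.

Lemma sqrt_iter_selfadjoint (k : nat) : rselfadjoint (sqrt_iter X k).
Proof.
induction k as [|k IH]; intros f g; cbn [sqrt_iter].
- replace (@zero ell2_AbelianMonoid) with (scal (RtoC 0) f)
    by (apply ell2_eq; intros n; simpl; ring).
  rewrite rinner_scal_r, rinner_scal_l; ring.
- now rewrite rinner_scal_l, rinner_scal_r, rinner_plus_l, rinner_plus_r,
    HXs, !IH.
Qed.

Lemma sqrt_iter_norm (k : nat) (f : ell2) :
  norm (sqrt_iter X k f) <= sqrt_iter_bound k * norm f.
Proof.
revert f; induction k as [|k IH]; intros f; cbn [sqrt_iter sqrt_iter_bound].
- rewrite norm_zero_ell2; lra.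
- eapply Rle_trans; [apply norm_half_plus|].
  assert (H1 := HX1 f); assert (H2 := IH (sqrt_iter X k f)).
  assert (H3 := IH f); assert (hy := sqrt_iter_bound_itv k).
  set (y := sqrt_iter_bound k) in *; nra.
Qed.

Lemma sqrt_iter_step (k : nat) (f : ell2) :
  norm (minus (sqrt_iter X (S k) f) (sqrt_iter X k f)) <=
  (sqrt_iter_bound (S k) - sqrt_iter_bound k) * norm f.
Proof.
revert f; induction k as [|k IH]; intros f.
- assert (E : minus (sqrt_iter X 1 f) (sqrt_iter X 0 f) =
              scal (RtoC (/ 2)) (plus (X f) (@zero ell2_AbelianMonoid))).
  { apply ell2_eq; intros n; cbn -[RtoC Rinv]; ring. }
  rewrite E; eapply Rle_trans; [apply norm_half_plus|].
  rewrite norm_zero_ell2; simpl sqrt_iter_bound; generalize (HX1 f); lra.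
- assert (HL := sqrt_iter_linear (S k)).
  (* A A - B B = A (A - B) + (A - B) B, so that A and B need not commute *)
  assert (E : minus (sqrt_iter X (S (S k)) f) (sqrt_iter X (S k) f) =
    scal (RtoC (/ 2)) (plus
      (sqrt_iter X (S k) (minus (sqrt_iter X (S k) f) (sqrt_iter X k f)))
      (minus (sqrt_iter X (S k) (sqrt_iter X k f))
             (sqrt_iter X k (sqrt_iter X k f))))).
  { rewrite (linear_minus _ _ _ HL).
    change (sqrt_iter X (S (S k)) f) with (scal (RtoC (/ 2))
      (plus (X f) (sqrt_iter X (S k) (sqrt_iter X (S k) f)))).
    change (sqrt_iter X (S k) f) with (scal (RtoC (/ 2))
      (plus (X f) (sqrt_iter X k (sqrt_iter X k f)))) at 2.
    apply ell2_eq; intros n; cbn -[sqrt_iter RtoC]; ring. }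
  rewrite E; eapply Rle_trans; [apply norm_half_plus|].
  set (d := minus (sqrt_iter X (S k) f) (sqrt_iter X k f)).
  assert (H1 := sqrt_iter_norm (S k) d).
  assert (H2 := IH f); fold d in H2.
  assert (H3 := IH (sqrt_iter X k f)).
  assert (H4 := sqrt_iter_norm k f).
  assert (hy := sqrt_iter_bound_itv (S k)).
  assert (hi := sqrt_iter_bound_incr k (S k) (Nat.le_succ_diag_r k)).
  change (sqrt_iter_bound (S (S k))) with
    (/ 2 * (1 + sqrt_iter_bound (S k) ^ 2)).
  assert (Ey : sqrt_iter_bound (S k) = / 2 * (1 + sqrt_iter_bound k ^ 2))
    by reflexivity.
  set (y' := sqrt_iter_bound (S k)) in *; set (y := sqrt_iter_bound k) in *.
  apply Rle_trans with
    (/ 2 * (y' * ((y' - y) * norm f) + (y' - y) * (y * norm f))).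
  + apply Rmult_le_compat_l; [lra|]; apply Rplus_le_compat.
    * apply Rle_trans with (1 := H1), Rmult_le_compat_l; [apply hy|exact H2].
    * apply Rle_trans with (1 := H3), Rmult_le_compat_l; [lra|exact H4].
  + right; transitivity ((/ 2 * (1 + y' ^ 2) - / 2 * (1 + y ^ 2)) * norm f).
    * field.
    * now rewrite <- Ey.
Qed.

Lemma sqrt_iter_cauchy (k j : nat) (f : ell2) : (k <= j)%nat ->
  norm (minus (sqrt_iter X j f) (sqrt_iter X k f)) <=
  (1 - sqrt_iter_bound k) * norm f.
Proof.
intros hkj; apply Rle_trans with
  ((sqrt_iter_bound j - sqrt_iter_bound k) * norm f).
- induction hkj as [|j hkj IH].
  + rewrite minus_eq_zero; change (norm zero) with (norm (@zero ell2_AbelianMonoid)).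
    rewrite norm_zero_ell2; lra.
  + replace (minus (sqrt_iter X (S j) f) (sqrt_iter X k f)) with
      (plus (minus (sqrt_iter X (S j) f) (sqrt_iter X j f))
            (minus (sqrt_iter X j f) (sqrt_iter X k f))).
    * eapply Rle_trans; [apply norm_plus_le|].
      generalize (sqrt_iter_step j f); lra.
    * apply ell2_eq; intros n; cbn -[sqrt_iter]; ring.
- apply Rmult_le_compat_r; [apply norm_ge_0|].
  generalize (sqrt_iter_bound_itv j); lra.
Qed.

(** [1 - Y] is the square root of [1 - X]. *)
Lemma complement_sqrt :
  exists Y : ell2 -> ell2,
    is_linear Y /\ rselfadjoint Y /\ (forall f, norm (Y f) <= norm f) /\
    forall f, Y f = scal (RtoC (/ 2)) (plus (X f) (Y (Y f))).
Proof.
destruct (functional_choice (fun f g => forall k,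
            norm (minus g (sqrt_iter X k f)) <=
            (1 - sqrt_iter_bound k) * norm f)) as [Y HY].
{ intros f; apply (ell2_complete (fun k => sqrt_iter X k f)
                     (fun k => (1 - sqrt_iter_bound k) * norm f)).
  - intros k j; apply sqrt_iter_cauchy.
  - apply sqrt_iter_bound_lim, norm_ge_0. }
assert (norm_minus_sym : forall f g : ell2, norm (minus f g) = norm (minus g f)).
{ intros f g; rewrite <- (opp_minus g f).
  exact (@norm_opp C_AbsRing ell2_NormedModule (minus g f)). }
assert (HL : forall f, filterlim (fun k => sqrt_iter X k f) eventually
                         (locally (Y f))).
{ intros f; apply ell2_lim_norm.
  apply is_lim_seq_squeeze0 with (fun k => (1 - sqrt_iter_bound k) * norm f).
  - intros k; rewrite Rabs_pos_eq, norm_minus_sym by apply norm_ge_0; apply HY.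
  - apply sqrt_iter_bound_lim, norm_ge_0. }
assert (Y1 : forall f, norm (Y f) <= norm f).
{ intros f; assert (H := HY f 0%nat).
  replace (minus (Y f) (sqrt_iter X 0 f)) with (Y f) in H
    by (apply ell2_eq; intros n; simpl; ring).
  simpl sqrt_iter_bound in H; lra. }
assert (Yplus : forall f g, Y (plus f g) = plus (Y f) (Y g)).
{ intros f g; apply (filterlim_locally_unique _ _ _ (HL (plus f g))).
  apply filterlim_ext with (fun k => plus (sqrt_iter X k f) (sqrt_iter X k g)).
  - intros k; symmetry; apply (linear_plus _ (sqrt_iter_linear k)).
  - now apply ell2_lim_plus. }
assert (Ylin : is_linear Y).
{ split; [exact Yplus| |exists 1; split; [lra|]].
  - intros c f; apply (filterlim_locally_unique _ _ _ (HL (scal c f))).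
    apply filterlim_ext with (fun k => scal c (sqrt_iter X k f)).
    + intros k; symmetry; apply (linear_scal _ (sqrt_iter_linear k)).
    + now apply ell2_lim_scal.
  - intros f; rewrite Rmult_1_l; apply Y1. }
exists Y; repeat split; try apply Ylin; [|exact Y1|].
- intros f g.
  assert (H1 := rinner_lim _ _ g (HL f)); assert (H2 := rinner_lim _ _ f (HL g)).
  apply is_lim_seq_ext with (v := fun k => rinner (sqrt_iter X k f) g) in H2.
  + apply is_lim_seq_unique in H1; apply is_lim_seq_unique in H2.
    rewrite H1 in H2; injection H2; intros E; rewrite E; apply rinner_sym.
  + intros k; rewrite rinner_sym; symmetry; apply sqrt_iter_selfadjoint.
- intros f.
  apply (@filterlim_locally_unique nat C_AbsRing ell2_NormedModule eventually _
           (fun k => sqrt_iter X (S k) f)).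
  + apply filterlim_comp with (2 := HL f); apply eventually_subseq; lia.
  + apply ell2_lim_scal, ell2_lim_plus; [apply filterlim_const|].
    apply ell2_lim_norm.
    apply is_lim_seq_squeeze0
      with (fun k => (1 - sqrt_iter_bound k) * (norm f + norm (Y f))).
    * intros k; rewrite Rabs_pos_eq by apply norm_ge_0.
      apply Rle_trans with (norm
        (plus (sqrt_iter X k (minus (sqrt_iter X k f) (Y f)))
              (minus (sqrt_iter X k (Y f)) (Y (Y f))))).
      -- right; apply (f_equal ell2_norm).
         rewrite (linear_minus _ _ _ (sqrt_iter_linear k)).
         exact (minus_trans (G := ell2_AbelianGroup) _ _ _).
      -- eapply Rle_trans; [apply norm_plus_le|].
         assert (H1 := sqrt_iter_norm k (minus (sqrt_iter X k f) (Y f))).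
         assert (H2 := HY f k); assert (H3 := HY (Y f) k).
         rewrite norm_minus_sym in H2, H3.
         assert (hy := sqrt_iter_bound_itv k).
         rewrite Rmult_plus_distr_l; apply Rplus_le_compat; [|exact H3].
         apply Rle_trans with (1 := H1), Rle_trans with (2 := H2).
         rewrite <- Rmult_1_l; apply Rmult_le_compat_r;
           [apply norm_ge_0|apply hy].
    * apply sqrt_iter_bound_lim.
      generalize (norm_ge_0 f) (norm_ge_0 (Y f)); lra.
Qed.

End SquareRoot.

(** With [|T| <= M], the operator [X = 1 - (T / M) ^ 2] is a self-adjoint
    contraction, and [M (1 - Y)] squares to [M ^ 2 (1 - X) = T ^ 2]; it is
    nonnegative because [Y] is a self-adjoint contraction as well. *)
Lemma selfadjoint_absolute_value (T : ell2 -> ell2) :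
  is_linear T -> rselfadjoint T ->
  exists P : ell2 -> ell2,
    is_linear P /\ rselfadjoint P /\ (forall f, 0 <= rinner (P f) f) /\
    forall f, P (P f) = T (T f).
Proof.
intros HT Hs; destruct (linear_norm _ HT) as [M [hM HM]].
set (t := - / M ^ 2).
set (X := fun f => plus f (scal (RtoC t) (T (T f)))).
assert (hM2 : 0 < M ^ 2) by (apply pow_lt; exact hM).
destruct (complement_sqrt X) as [Y [HY [HYs [HY1 HYX]]]].
- apply is_linear_add; [exact (@is_linear_id C_AbsRing ell2_NormedModule)|].
  apply is_linear_scale; exact (is_linear_comp _ _ HT HT).
- intros f g; unfold X.
  now rewrite rinner_plus_l, rinner_plus_r, rinner_scal_l, rinner_scal_r, !Hs.
- intros f; unfold X.
  apply Rsqr_incr_0_var; [rewrite !Rsqr_pow2|apply norm_ge_0].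
  rewrite norm_plus_sqr, rinner_scal_r, <- Hs, rinner_self, norm_scal_ell2,
    Rpow_mult_distr, Cmod_R, pow2_abs.
  assert (H2 : norm (T (T f)) ^ 2 <= (M * norm (T f)) ^ 2).
  { apply pow_incr; split; [apply norm_ge_0|apply HM]. }
  assert (Et : t * M ^ 2 = -1) by (unfold t; field; lra).
  assert (ht : t < 0).
  { unfold t; generalize (Rinv_0_lt_compat _ hM2); lra. }
  assert (H3 : t ^ 2 * norm (T (T f)) ^ 2 <= t ^ 2 * (M * norm (T f)) ^ 2).
  { apply Rmult_le_compat_l; [apply pow2_ge_0|exact H2]. }
  replace (t ^ 2 * (M * norm (T f)) ^ 2)
    with (- t * - (t * M ^ 2) * norm (T f) ^ 2) in H3 by ring.
  rewrite Et in H3; generalize (pow2_ge_0 (norm (T f))); nra.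
- set (P := fun f => scal (RtoC M) (plus f (scal (RtoC (-1)) (Y f)))).
  assert (HP : is_linear P).
  { apply is_linear_scale, is_linear_add;
      [exact (@is_linear_id C_AbsRing ell2_NormedModule)|].
    now apply is_linear_scale. }
  exists P; repeat split; try apply HP.
  + intros f g; unfold P.
    now rewrite rinner_scal_l, rinner_scal_r, rinner_plus_l, rinner_plus_r,
      rinner_scal_l, rinner_scal_r, HYs.
  + intros f; unfold P.
    rewrite rinner_scal_l, rinner_plus_l, rinner_scal_l, rinner_self.
    assert (H := rinner_cauchy_schwarz (Y f) f).
    apply Rabs_le_between in H.
    assert (H1 := HY1 f); assert (h := norm_ge_0 f).
    apply Rmult_le_pos; [lra|]; nra.
  + intros f; apply ell2_eq; intros n.
    assert (E : P (P f) n = (M * (M * (f n + RtoC (-1) * Y f n +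
                  RtoC (-1) * (Y f n + RtoC (-1) * Y (Y f) n))))%C).
    { unfold P at 1.
      assert (E : Y (P f) = scal (RtoC M) (plus (Y f) (scal (RtoC (-1)) (Y (Y f))))).
      { unfold P.
        now rewrite (linear_scal _ HY), (linear_plus _ HY), (linear_scal _ HY). }
      rewrite E; unfold P; simpl; ring. }
    assert (EY : (RtoC 2 * Y f n = f n + RtoC t * T (T f) n + Y (Y f) n)%C).
    { rewrite (HYX f) at 1; unfold X.
      replace (RtoC (/ 2)) with (/ RtoC 2)%C by (rewrite RtoC_inv; [easy|lra]).
      simpl; field; intros E2; apply (f_equal Re) in E2; simpl in E2; lra. }
    rewrite E.
    replace (f n + RtoC (-1) * Y f n +
             RtoC (-1) * (Y f n + RtoC (-1) * Y (Y f) n))%C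
      with (f n + Y (Y f) n - RtoC 2 * Y f n)%C
      by (apply injective_projections; simpl; ring).
    rewrite EY.
    replace (M * (M * (f n + Y (Y f) n -
                       (f n + RtoC t * T (T f) n + Y (Y f) n))))%C
      with (- RtoC (t * M ^ 2) * T (T f) n)%C
      by (apply injective_projections; simpl; ring).
    replace (t * M ^ 2) with (-1) by (unfold t; field; lra).
    apply injective_projections; simpl; ring.
Qed.

Lemma rselfadjoint_adjoint (T : ell2 -> ell2) :
  is_linear T -> rselfadjoint T -> is_adjoint T T.
Proof.
intros HT Hs; split; [exact HT|]; intros f g.
rewrite !inner_rinner, !Hs; f_equal; f_equal; apply (linear_scal _ HT).
Qed.

Lemma rselfadjoint_positive (P : ell2 -> ell2) :
  is_linear P -> rselfadjoint P -> (forall f, 0 <= rinner (P f) f) ->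
  positive_operator P.
Proof.
intros HP Hs Hp; split; [exact HP|]; intros f.
rewrite inner_rinner; split; simpl; [apply Hp|].
assert (E : rinner (P f) (scal Ci f) = - rinner (P f) (scal Ci f)); [|lra].
transitivity (rinner f (P (scal Ci f))); [apply Hs|].
assert (Ei : P (scal Ci f) = scal Ci (P f)) by apply (linear_scal _ HP).
rewrite Ei.
rewrite (rinner_sym (P f)), rinner_Ci_l; ring.
Qed.

(** The diagonal entry of [|T|] at [n] is at most
    [norm (|T| (ebasis n)) = norm (T (ebasis n))]. *)
Lemma selfadjoint_trace_class (T : ell2 -> ell2) :
  is_linear T -> rselfadjoint T -> ex_series (fun n => norm (T (ebasis n))) ->
  trace_class_operator T.
Proof.
intros HT Hs HN; split; [exact HT|].
destruct (selfadjoint_absolute_value T HT Hs) as [P [HP [HPs [HP0 HPT]]]].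
exists P; split.
- split; [now apply rselfadjoint_positive|].
  exists T; split; [now apply rselfadjoint_adjoint|exact HPT].
- apply (@ex_series_le R_AbsRing R_CompleteNormedModule _
           (fun n => norm (T (ebasis n)))); [|exact HN].
  intros n; change (Rabs (rinner (P (ebasis n)) (ebasis n)) <=
                    norm (T (ebasis n))).
  eapply Rle_trans; [apply rinner_cauchy_schwarz|].
  rewrite norm_ebasis, Rmult_1_r.
  apply Rsqr_incr_0_var; [rewrite !Rsqr_pow2|apply norm_ge_0].
  rewrite <- !rinner_self, HPs, HPT, Hs; apply Rle_refl.
Qed.

(** * Operators given by their rows *)

Section OperatorFromRows.

(** The row vectors are stored conjugated, so that applying the matrix means
    taking inner products with them. *)
Variable r : nat -> ell2.
Variable B : R.
Hypothesis HB : forall (f : ell2) N,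
  sum_n (fun n => Cmod (inner f (r n)) ^ 2) N <= B ^ 2 * norm f ^ 2.

Lemma row_operator_summable (f : ell2) :
  ex_series (fun n => Cmod (inner f (r n)) ^ 2).
Proof.
apply (Series_bounded _ (B ^ 2 * norm f ^ 2)); [|apply HB].
intros n; apply pow2_ge_0.
Qed.

Definition row_operator (f : ell2) : ell2 := Ell2 _ (row_operator_summable f).

Lemma row_operator_linear : is_linear row_operator.
Proof.
split.
- intros f g; apply ell2_eq; intros n; apply inner_plus_l.
- intros c f; apply ell2_eq; intros n; apply inner_scal_l.
- exists (Rabs B + 1); split; [generalize (Rabs_pos B); lra|]; intros f.
  apply Rle_trans with (Rabs B * norm f).
  + apply Rsqr_incr_0_var; [rewrite !Rsqr_pow2|].
    * rewrite norm_sqr_Series, Rpow_mult_distr, pow2_abs.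
      apply (Series_bounded _ (B ^ 2 * norm f ^ 2)); [|apply HB].
      intros n; apply pow2_ge_0.
    * apply Rmult_le_pos; [apply Rabs_pos|apply norm_ge_0].
  + apply Rmult_le_compat_r; [apply norm_ge_0|lra].
Qed.

Lemma row_operator_matrix : has_matrix row_operator (fun n m => Cconj (r n m)).
Proof. intros n m; apply inner_ebasis_l. Qed.

Lemma row_operator_selfadjoint :
  (forall n m, r n m = Cconj (r m n)) -> rselfadjoint row_operator.
Proof.
intros Hr; apply rselfadjoint_from_basis; [apply row_operator_linear|].
intros c m g.
assert (E : row_operator (scal c (ebasis m)) = scal c (r m)).
{ apply ell2_eq; intros n.
  change (inner (scal c (ebasis m)) (r n) = (c * r m n)%C).
  now rewrite inner_scal_l, inner_ebasis_l, (Hr m n). }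
rewrite E.
change (Re (inner (scal c (r m)) g) =
        Re (inner (scal c (ebasis m)) (row_operator g))).
rewrite !inner_scal_l, inner_ebasis_l.
change (row_operator g m) with (inner g (r m)).
now rewrite <- inner_conj.
Qed.

End OperatorFromRows.

(** * Compactness by diagonal extraction *)

Lemma bounded_real_subsequence (u : nat -> R) (B : R) :
  (forall k, Rabs (u k) <= B) ->
  exists phi : nat -> nat, (forall k, (phi k < phi (S k))%nat) /\
    ex_finite_lim_seq (fun k => u (phi k)).
Proof.
intros HB.
destruct (Bolzano_Weierstrass u (fun x => - B <= x <= B) (compact_P3 (- B) B))
  as [l Hl].
{ intros k; apply Rabs_le_between, HB. }
destruct (functional_choice (fun (Nk : nat * nat) p =>
    (fst Nk <= p)%nat /\ Rabs (u p - l) < / (INR (snd Nk) + 1))) as [c Hc].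
{ intros [N k].
  assert (he : 0 < / (INR k + 1)).
  { apply Rinv_0_lt_compat; generalize (pos_INR k); lra. }
  destruct (Hl (disc l (mkposreal _ he)) N) as [p [hp Hp]].
  - exists (mkposreal _ he); now intros y hy.
  - exists p; split; [exact hp|exact Hp]. }
set (phi := fix phi k := match k with
                         | 0%nat => c (0, 0)%nat
                         | S k => c (S (phi k), S k)
                         end).
exists phi; split.
- intros k; apply (Hc (S (phi k), S k)).
- exists l; apply is_lim_seq_minus0.
  apply is_lim_seq_squeeze0 with (fun k => / (INR k + 1)).
  + intros k; left; destruct k as [|k].
    * apply (Hc (0, 0)%nat).
    * apply (Hc (S (phi k), S k)).
  + apply (is_lim_seq_inv (fun k => INR k + 1) p_infty); [|easy].
    eapply is_lim_seq_plus; [apply is_lim_seq_INR|apply is_lim_seq_const|easy].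
Qed.

Lemma strictly_increasing_le (phi : nat -> nat) :
  (forall k, (phi k < phi (S k))%nat) -> forall k, (k <= phi k)%nat.
Proof. intros H k; induction k as [|k IH]; [lia|specialize (H k); lia]. Qed.

Lemma strictly_increasing_lt (phi : nat -> nat) :
  (forall k, (phi k < phi (S k))%nat) ->
  forall j k, (j < k)%nat -> (phi j < phi k)%nat.
Proof.
intros H j k hjk; induction hjk as [|k hjk IH]; [apply H|].
specialize (H k); lia.
Qed.

(** Cantor's diagonal: the [n]-th refinement [Phi n] makes the first [n]
    sequences converge, and [Phi k k] is eventually a subsequence of each. *)
Lemma diagonal_subsequence (u : nat -> nat -> R) (B : nat -> R) :
  (forall n k, Rabs (u n k) <= B n) ->
  exists phi : nat -> nat, (forall k, (phi k < phi (S k))%nat) /\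
    forall n, ex_finite_lim_seq (fun k => u n (phi k)).
Proof.
intros HB.
destruct (functional_choice (fun (v : nat -> R) (psi : nat -> nat) =>
    (exists b, forall k, Rabs (v k) <= b) ->
    (forall k, (psi k < psi (S k))%nat) /\
    ex_finite_lim_seq (fun k => v (psi k)))) as [E HE].
{ intros v; destruct (classic (exists b, forall k, Rabs (v k) <= b)) as [[b hb]|h].
  - destruct (bounded_real_subsequence v b hb) as [psi Hpsi]; now exists psi.
  - exists (fun k => k); tauto. }
set (Phi := fix Phi n := match n with
                         | 0%nat => fun k => k
                         | S n => fun k => Phi n (E (fun j => u n (Phi n j)) k)
                         end).
set (psi := fun n => E (fun j => u n (Phi n j))).
assert (Hpsi : forall n, (forall k, (psi n k < psi n (S k))%nat) /\
                         ex_finite_lim_seq (fun k => u n (Phi n (psi n k)))).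
{ intros n; apply (HE (fun j => u n (Phi n j))).
  exists (B n); intros k; apply HB. }
assert (HPhi : forall n k, (Phi n k < Phi n (S k))%nat).
{ induction n as [|n IH]; intros k; [simpl; lia|].
  change (Phi n (psi n k) < Phi n (psi n (S k)))%nat.
  apply (strictly_increasing_lt _ IH), Hpsi. }
exists (fun k => Phi k k); split.
- intros k; change (Phi (S k) (S k)) with (Phi k (psi k (S k))).
  apply (strictly_increasing_lt _ (HPhi k)).
  apply (strictly_increasing_le _ (proj1 (Hpsi k)) (S k)).
- intros n; destruct (proj2 (Hpsi n)) as [l Hl]; exists l.
  assert (Htheta : forall d k, exists j, (k <= j)%nat /\
                     Phi (S n + d)%nat k = Phi n (psi n j)).
  { induction d as [|d IH]; intros k.
    - exists k; rewrite Nat.add_0_r; now split.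
    - rewrite Nat.add_succ_r.
      change (Phi (S (S n + d)) k) with (Phi (S n + d)%nat (psi (S n + d)%nat k)).
      destruct (IH (psi (S n + d)%nat k)) as [j [hj Ej]].
      exists j; split; [|exact Ej].
      generalize (strictly_increasing_le _ (proj1 (Hpsi (S n + d)%nat)) k); lia. }
  apply is_lim_seq_spec; apply is_lim_seq_spec in Hl; intros eps.
  destruct (Hl eps) as [N HN]; exists (Nat.max N (S n)); intros k hk.
  destruct (Htheta (k - S n)%nat k) as [j [hj Ej]].
  replace (S n + (k - S n))%nat with k in Ej by lia.
  rewrite Ej; apply HN; lia.
Qed.

Lemma bounded_coordinates_subsequence (x : nat -> nat -> C) (B : nat -> R) :
  (forall k n, Cmod (x k n) <= B n) ->
  exists phi : nat -> nat, (forall k, (phi k < phi (S k))%nat) /\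
    exists v : nat -> C, forall n,
      is_lim_seq (fun k => Cmod (x (phi k) n - v n)%C) 0.
Proof.
intros HB.
destruct (diagonal_subsequence
  (fun i k => if Nat.even i then Re (x k (Nat.div2 i)) else Im (x k (Nat.div2 i)))
  (fun i => B (Nat.div2 i))) as [phi [Hphi H]].
{ intros i k; eapply Rle_trans; [|apply (HB k)].
  destruct (Nat.even i); [apply re_le_Cmod|apply Im_le_Cmod]. }
exists phi; split; [exact Hphi|].
apply (functional_choice (fun n l =>
         is_lim_seq (fun k => Cmod (x (phi k) n - l)%C) 0)).
intros n.
destruct (H (2 * n)%nat) as [a Ha]; destruct (H (S (2 * n))%nat) as [b Hb].
rewrite Nat.even_even, Nat.div2_double in Ha.
rewrite <- Nat.add_1_r, Nat.even_odd, Nat.add_1_r, Nat.div2_succ_double in Hb.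
exists (a, b); now apply Cmod_minus_lim0.
Qed.

(** A bounded sequence is mapped into a box of points [v] with
    [|v n| <= M * b n], where coordinatewise convergence is convergence in norm
    because [b] is square-summable. *)
Lemma dominated_coordinates_compact (T : ell2 -> ell2) (b : nat -> R) :
  is_linear T -> ex_series (fun n => b n ^ 2) ->
  (forall f n, Cmod (T f n) <= norm f * b n) -> compact_operator T.
Proof.
intros HT Hb Hd; split; [exact HT|]; intros f [M HM].
assert (hb : forall n, 0 <= b n).
{ intros n; assert (h := Hd (ebasis 0) n); rewrite norm_ebasis in h.
  generalize (Cmod_ge_0 (T (ebasis 0) n)); lra. }
assert (hTf : forall k n, Cmod (T (f k) n) <= M * b n).
{ intros k n; eapply Rle_trans; [apply Hd|].
  apply Rmult_le_compat_r; [apply hb|apply HM]. }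
destruct (bounded_coordinates_subsequence (fun k => T (f k)) (fun n => M * b n))
  as [phi [Hphi [v Hv]]]; [exact hTf|].
exists phi; split; [exact Hphi|].
assert (hv : forall n, Cmod (v n) <= M * b n).
{ intros n.
  apply (is_lim_seq_le (fun _ => Cmod (v n))
           (fun k => Cmod (T (f (phi k)) n - v n)%C + M * b n)
           (Cmod (v n)) (M * b n)).
  - intros k; replace (v n) with
      (- (T (f (phi k)) n - v n) + T (f (phi k)) n)%C at 1 by ring.
    eapply Rle_trans; [apply Cmod_triangle|].
    rewrite Cmod_opp; apply Rplus_le_compat_l, hTf.
  - apply is_lim_seq_const.
  - replace (M * b n) with (0 + M * b n) at 1 by ring.
    apply is_lim_seq_plus'; [apply Hv|apply is_lim_seq_const]. }
assert (hD : ex_series (fun n => (2 * (M * b n)) ^ 2)).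
{ apply ex_series_ext with (fun n => (2 * M) ^ 2 * b n ^ 2).
  - intros n; now rewrite <- Rpow_mult_distr, Rmult_assoc.
  - now apply (@ex_series_scal R_AbsRing R_NormedModule). }
assert (hD1 : ex_series (fun n => Cmod (v n) ^ 2)).
{ apply summable_dominated with (2 := hD); intros n.
  apply pow_incr; split; [apply Cmod_ge_0|].
  generalize (hv n) (Cmod_ge_0 (v n)); lra. }
exists (Ell2 v hD1); apply ell2_lim_norm.
apply is_lim_seq_ext with (fun k => sqrt (Series (fun n =>
  Cmod (T (f (phi k)) n - v n)%C ^ 2))); [reflexivity|].
rewrite <- sqrt_0; apply (is_lim_seq_continuous sqrt).
- apply continuity_pt_sqrt; lra.
- apply Series_dominated_lim0 with (2 := hD).
  + intros k n; split; [apply pow2_ge_0|].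
    apply pow_incr; split; [apply Cmod_ge_0|].
    eapply Rle_trans; [apply Cmod_triangle|].
    rewrite Cmod_opp; generalize (hTf (phi k) n) (hv n); lra.
  + intros n; replace 0 with (0 * (0 * 1)) by ring.
    apply is_lim_seq_mult'; [apply Hv|].
    apply is_lim_seq_mult'; [apply Hv|apply is_lim_seq_const].
Qed.

(** * Criteria on the entries of a matrix *)

(** The norm of [r n] bounds the [n]-th coordinate of [T f] for [norm f <= 1]
    and, by hermitian symmetry, is also the norm of the [n]-th column
    [T (ebasis n)]. *)
Lemma hermitian_summable_rows (r : nat -> ell2) (A : imatrix) :
  (forall n m, A n m = Cconj (r n m)) -> (forall n m, r n m = Cconj (r m n)) ->
  ex_series (fun n => norm (r n)) ->
  bounded_matrix A /\ compact_matrix A /\ trace_class_matrix A.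
Proof.
intros HA Hr Hs.
assert (h0 : forall n, 0 <= norm (r n)) by (intros n; apply norm_ge_0).
assert (Hs2 : ex_series (fun n => norm (r n) ^ 2)).
{ apply (@ex_series_le R_AbsRing R_CompleteNormedModule _
           (fun n => Series (fun n => norm (r n)) * norm (r n))).
  - intros n; change (Rabs (norm (r n) ^ 2) <=
                      Series (fun n => norm (r n)) * norm (r n)).
    rewrite Rabs_pos_eq by apply pow2_ge_0.
    assert (H := term_le_Series _ n h0 Hs); simpl in H.
    rewrite <- Rsqr_pow2; apply Rmult_le_compat_r; [apply h0|exact H].
  - now apply (@ex_series_scal R_AbsRing R_NormedModule). }
set (B := sqrt (Series (fun n => norm (r n) ^ 2))).
assert (EB : B ^ 2 = Series (fun n => norm (r n) ^ 2)).
{ apply pow2_sqrt, Series_nonneg; [intros n; apply pow2_ge_0|exact Hs2]. }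
assert (HB : forall (f : ell2) N,
  sum_n (fun n => Cmod (inner f (r n)) ^ 2) N <= B ^ 2 * norm f ^ 2).
{ intros f N; apply Rle_trans with
    (sum_n (fun n => mult (norm (r n) ^ 2) (norm f ^ 2)) N).
  - rewrite !sum_n_Reals; apply sum_Rle; intros n _.
    change (Cmod (inner f (r n)) ^ 2 <= norm (r n) ^ 2 * norm f ^ 2).
    rewrite <- Rpow_mult_distr; apply pow_incr; split; [apply Cmod_ge_0|].
    rewrite Rmult_comm; apply inner_cauchy_schwarz.
  - rewrite sum_n_mult_r; apply Rmult_le_compat_r; [apply pow2_ge_0|].
    rewrite EB; apply sum_n_le_Series; [intros n; apply pow2_ge_0|exact Hs2]. }
set (T := row_operator r B HB).
assert (HT : is_linear T) by apply row_operator_linear.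
assert (HTA : has_matrix T A).
{ intros n m; rewrite HA; apply row_operator_matrix. }
repeat split; exists T; (split; [|exact HTA]).
- exact HT.
- apply dominated_coordinates_compact with (fun n => norm (r n));
    [exact HT|exact Hs2|].
  intros f n; apply inner_cauchy_schwarz.
- apply selfadjoint_trace_class; [exact HT|now apply row_operator_selfadjoint|].
  apply ex_series_ext with (2 := Hs); intros n; f_equal.
  apply ell2_eq; intros m; rewrite HTA, HA; apply Hr.
Qed.

(** Schur's test: splitting [K = sqrt K * sqrt K] in the Cauchy-Schwarz
    inequality bounds [|(T f) n| ^ 2] by [M * sum_m K n m * |f m| ^ 2], and the
    column sums are bounded by [M] again. *)
Lemma schur_test (K : nat -> nat -> R) (M : R) :
  (forall n m, 0 <= K n m) -> (forall n m, K n m = K m n) ->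
  (forall n N, sum_n (K n) N <= M) ->
  bounded_matrix (fun n m => RtoC (K n m)).
Proof.
intros HK HKs HM.
assert (Hex : forall n, ex_series (K n) /\ Series (K n) <= M).
{ intros n; now apply Series_bounded. }
assert (hM : 0 <= M).
{ apply Rle_trans with (sum_n (K 0%nat) 0); [rewrite sum_O; apply HK|apply HM]. }
assert (HKM : forall n m, K n m <= M).
{ intros n m; apply Rle_trans with (Series (K n)); [|apply Hex].
  apply (term_le_Series (K n)); [apply HK|apply Hex]. }
assert (Hrow : forall n, ex_series (fun m => Cmod (RtoC (K n m)) ^ 2)).
{ intros n; apply summable_dominated with (fun m => M * K n m).
  - intros m; rewrite Cmod_R, pow2_abs.
    generalize (HK n m) (HKM n m); nra.
  - apply (@ex_series_scal R_AbsRing R_NormedModule), Hex. }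
set (r := fun n => Ell2 (fun m => RtoC (K n m)) (Hrow n)).
assert (Hweight : forall (f : ell2) n, ex_series (fun m => K n m * Cmod (f m) ^ 2)).
{ intros f n; apply (@ex_series_le R_AbsRing R_CompleteNormedModule _
           (fun m => M * Cmod (f m) ^ 2)).
  - intros m; assert (h := pow2_ge_0 (Cmod (f m))).
    change (Rabs (K n m * Cmod (f m) ^ 2) <= M * Cmod (f m) ^ 2).
    rewrite Rabs_pos_eq by (apply Rmult_le_pos; [apply HK|exact h]).
    apply Rmult_le_compat_r; [exact h|apply HKM].
  - apply (@ex_series_scal R_AbsRing R_NormedModule), ell2_summable. }
assert (Hcs : forall (f : ell2) n, Cmod (inner f (r n)) ^ 2 <=
                 M * Series (fun m => K n m * Cmod (f m) ^ 2)).
{ intros f n.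
  assert (Eu : forall m, Cmod (RtoC (sqrt (K n m)) * f m)%C ^ 2 =
                         K n m * Cmod (f m) ^ 2).
  { intros m; rewrite Cmod_mult, Cmod_R, Rpow_mult_distr, pow2_abs.
    rewrite pow2_sqrt by apply HK; reflexivity. }
  assert (Ev : forall m, Cmod (RtoC (sqrt (K n m))) ^ 2 = K n m).
  { intros m; rewrite Cmod_R, pow2_abs; apply pow2_sqrt, HK. }
  assert (Su : ex_series (fun m => Cmod (RtoC (sqrt (K n m)) * f m)%C ^ 2)).
  { apply ex_series_ext with (2 := Hweight f n); intros m; now rewrite Eu. }
  assert (Sv : ex_series (fun m => Cmod (RtoC (sqrt (K n m))) ^ 2)).
  { apply ex_series_ext with (2 := proj1 (Hex n)); intros m; now rewrite Ev. }
  assert (E : inner f (r n) = inner (Ell2 _ Su) (Ell2 _ Sv)).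
  { assert (Ek : forall m, (f m * Cconj (r n m))%C =
        (RtoC (sqrt (K n m)) * f m * Cconj (RtoC (sqrt (K n m))))%C).
    { intros m; change (r n m) with (RtoC (K n m)).
      rewrite <- (sqrt_sqrt (K n m)) at 1 by apply HK.
      destruct (f m); apply injective_projections; simpl; ring. }
    unfold inner; f_equal; apply Series_ext; intros m; now rewrite Ek. }
  apply Rle_trans with (norm (Ell2 _ Sv) ^ 2 * norm (Ell2 _ Su) ^ 2).
  - rewrite <- Rpow_mult_distr; apply pow_incr; split; [apply Cmod_ge_0|].
    rewrite E, Rmult_comm; apply inner_cauchy_schwarz.
  - rewrite !norm_sqr_Series; simpl ell2_val.
    rewrite (Series_ext _ _ Eu), (Series_ext _ _ Ev).
    apply Rmult_le_compat_r; [|apply Hex].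
    apply Series_nonneg; [|apply Hweight].
    intros m; apply Rmult_le_pos; [apply HK|apply pow2_ge_0]. }
assert (HB : forall (f : ell2) N,
  sum_n (fun n => Cmod (inner f (r n)) ^ 2) N <= M ^ 2 * norm f ^ 2).
{ intros f N.
  set (S0 := fun n => Series (fun m => K n m * Cmod (f m) ^ 2)).
  assert (HS : ex_series (fun m => sum_n (fun n => K n m) N * Cmod (f m) ^ 2) /\
    sum_n S0 N = Series (fun m => sum_n (fun n => K n m) N * Cmod (f m) ^ 2)).
  { induction N as [|N [IH1 IH2]].
    - split; [apply ex_series_ext with (2 := Hweight f 0%nat)|
              rewrite sum_O; apply Series_ext]; intros m; now rewrite sum_O.
    - assert (Es : forall m, sum_n (fun n => K n m) N * Cmod (f m) ^ 2 +
          K (S N) m * Cmod (f m) ^ 2 =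
          sum_n (fun n => K n m) (S N) * Cmod (f m) ^ 2).
      { intros m; rewrite sum_Sn; unfold plus; simpl; ring. }
      split.
      + apply ex_series_ext with (1 := Es).
        apply (@ex_series_plus R_AbsRing R_NormedModule _ _ IH1 (Hweight f (S N))).
      + rewrite sum_Sn, IH2, <- (Series_ext _ _ Es).
        symmetry; apply (Series_plus _ _ IH1 (Hweight f (S N))). }
  apply Rle_trans with (sum_n (fun n => mult M (S0 n)) N).
  - rewrite !sum_n_Reals; apply sum_Rle; intros n _; apply Hcs.
  - rewrite sum_n_mult_l; change (M * sum_n S0 N <= M ^ 2 * norm f ^ 2).
    rewrite (proj2 HS), norm_sqr_Series.
    replace (M ^ 2) with (M * M) by ring.
    rewrite Rmult_assoc; apply Rmult_le_compat_l; [exact hM|].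
    rewrite <- Series_scal_l; apply Series_le.
    + intros m; assert (h := pow2_ge_0 (Cmod (f m))); split.
      * apply Rmult_le_pos; [|exact h].
        rewrite sum_n_Reals; apply cond_pos_sum; intros n; apply HK.
      * apply Rmult_le_compat_r; [exact h|].
        rewrite (sum_n_ext _ (K m)); [apply HM|intros n; apply HKs].
    + apply (@ex_series_scal R_AbsRing R_NormedModule), ell2_summable. }
exists (row_operator r M HB); split; [apply row_operator_linear|].
intros n m; rewrite row_operator_matrix; change (r n m) with (RtoC (K n m)).
apply injective_projections; simpl; ring.
Qed.

Lemma geometric_decay_matrix (K : nat -> nat -> R) (c : R) :
  0 < c < 1 -> (forall n m, 0 <= K n m <= c ^ (n + m)) ->
  (forall n m, K n m = K m n) ->
  bounded_matrix (fun n m => RtoC (K n m)) /\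
  compact_matrix (fun n m => RtoC (K n m)) /\
  trace_class_matrix (fun n m => RtoC (K n m)).
Proof.
intros hc HK HKs.
assert (Hgeom : ex_series (fun m => (c ^ 2) ^ m)).
{ apply ex_series_geom; rewrite Rabs_pos_eq by apply pow2_ge_0; nra. }
assert (Hle : forall n m, Cmod (RtoC (K n m)) ^ 2 <= (c ^ n) ^ 2 * (c ^ 2) ^ m).
{ intros n m; rewrite Cmod_R, Rabs_pos_eq by apply HK.
  replace ((c ^ n) ^ 2 * (c ^ 2) ^ m) with ((c ^ (n + m)) ^ 2).
  - apply pow_incr, HK.
  - rewrite pow_add, Rpow_mult_distr, <- !pow_mult; f_equal; f_equal; lia. }
assert (Hle_ex : forall n, ex_series (fun m => (c ^ n) ^ 2 * (c ^ 2) ^ m)).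
{ intros n; now apply (@ex_series_scal R_AbsRing R_NormedModule). }
set (r := fun n => Ell2 (fun m => RtoC (K n m))
                        (summable_dominated _ _ (Hle n) (Hle_ex n))).
assert (Hconj : forall x : R, Cconj (RtoC x) = RtoC x).
{ intros x; apply injective_projections; simpl; ring. }
apply (hermitian_summable_rows r).
- intros n m; symmetry; apply Hconj.
- intros n m; simpl; now rewrite Hconj, HKs.
- set (L := sqrt (Series (fun m => (c ^ 2) ^ m))).
  apply (@ex_series_le R_AbsRing R_CompleteNormedModule _ (fun n => L * c ^ n)).
  + intros n; change (Rabs (norm (r n)) <= L * c ^ n).
    assert (hcn : 0 <= c ^ n) by (apply pow_le; lra).
    rewrite Rabs_pos_eq by apply norm_ge_0.
    apply Rsqr_incr_0_var; [rewrite !Rsqr_pow2|].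
    * rewrite norm_sqr_Series, Rpow_mult_distr; unfold L; rewrite pow2_sqrt.
      -- rewrite Rmult_comm, <- Series_scal_l; apply Series_le; [|apply Hle_ex].
         intros m; split; [apply pow2_ge_0|apply Hle].
      -- apply Series_nonneg; [|exact Hgeom].
         intros m; apply pow_le, pow2_ge_0.
    * apply Rmult_le_pos; [apply sqrt_pos|exact hcn].
  + apply (@ex_series_scal R_AbsRing R_NormedModule), ex_series_geom.
    rewrite Rabs_pos_eq; lra.
Qed.

Lemma bounded_matrix_entries (A : imatrix) : bounded_matrix A ->
  exists M, forall n m, Cmod (A n m) <= M.
Proof.
intros [T [HT HA]]; destruct (linear_norm _ HT) as [M [_ HM]].
exists M; intros n m; rewrite <- HA.
eapply Rle_trans; [apply ell2_Cmod_le_norm|].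
generalize (HM (ebasis m)); rewrite norm_ebasis, Rmult_1_r; easy.
Qed.

Lemma bounded_matrix_column (A : imatrix) (m : nat) : bounded_matrix A ->
  ex_series (fun n => Cmod (A n m) ^ 2).
Proof.
intros [T [_ HA]]; apply ex_series_ext with (2 := ell2_summable (T (ebasis m))).
intros n; now rewrite HA.
Qed.

(** The images of the basis vectors tend to zero coordinatewise, while their
    norms stay at least 1. *)
Lemma not_compact_matrix (A : imatrix) :
  (forall n, is_lim_seq (fun m => Cmod (A n m)) 0) ->
  (forall n, 1 <= Cmod (A n n)) -> ~ compact_matrix A.
Proof.
intros Hrow Hdiag [T [[_ HT] HA]].
destruct (HT ebasis) as [phi [Hphi [g Hg]]].
{ exists 1; intros k; rewrite norm_ebasis; apply Rle_refl. }
apply ell2_lim_norm in Hg.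
assert (Hco : forall k n, Cmod (A n (phi k) - g n)%C <=
                          norm (minus (T (ebasis (phi k))) g)).
{ intros k n; rewrite <- HA.
  exact (ell2_Cmod_le_norm (minus (T (ebasis (phi k))) g) n). }
assert (Hg0 : forall n, g n = RtoC 0).
{ intros n; apply Cmod_eq_0, Rle_antisym; [|apply Cmod_ge_0].
  apply (is_lim_seq_le (fun _ => Cmod (g n))
           (fun k => norm (minus (T (ebasis (phi k))) g) + Cmod (A n (phi k)))
           (Cmod (g n)) 0).
  - intros k; replace (g n) with (- (A n (phi k) - g n) + A n (phi k))%C at 1
      by ring.
    eapply Rle_trans; [apply Cmod_triangle|].
    rewrite Cmod_opp; apply Rplus_le_compat_r, Hco.
  - apply is_lim_seq_const.
  - replace 0 with (0 + 0) by ring; apply is_lim_seq_plus'; [exact Hg|].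
    apply is_lim_seq_subseq with (2 := Hrow n).
    now apply eventually_subseq. }
apply is_lim_seq_spec in Hg; destruct (Hg (mkposreal 1 Rlt_0_1)) as [N HN].
specialize (HN N (Nat.le_refl N)); simpl in HN.
rewrite Rminus_0_r, Rabs_pos_eq in HN by apply norm_ge_0.
assert (H := Hco N (phi N)); assert (H1 := Hdiag (phi N)).
rewrite Hg0 in H; replace (A (phi N) (phi N) - 0)%C with (A (phi N) (phi N)) in H
  by ring.
lra.
Qed.

(** * The kernel a ^ |n - m| * b ^ (n + m) *)

Definition exp_kernel (a b : R) (n m : nat) : R :=
  a ^ (Nat.max n m - Nat.min n m) * b ^ (n + m).

Lemma exp_kernel_sym (a b : R) (n m : nat) :
  exp_kernel a b n m = exp_kernel a b m n.
Proof.
unfold exp_kernel; now rewrite Nat.max_comm, Nat.min_comm, Nat.add_comm.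
Qed.

Lemma exp_kernel_diag (a b : R) (n : nat) : exp_kernel a b n n = b ^ (n + n).
Proof.
unfold exp_kernel; rewrite Nat.max_id, Nat.min_id, Nat.sub_diag; simpl; ring.
Qed.

Lemma exp_kernel_col0 (a b : R) (n : nat) : exp_kernel a b n 0 = (a * b) ^ n.
Proof.
unfold exp_kernel; rewrite Nat.max_0_r, Nat.min_0_r, Nat.sub_0_r, Nat.add_0_r.
symmetry; apply Rpow_mult_distr.
Qed.

(** [max n m - (n + m) / 2 = |n - m| / 2]. *)
Lemma Amat_exp_kernel (q tau rho : R) (n m : nat) :
  Amat q tau rho n m =
  RtoC (exp_kernel (Rpower q (tau / 2)) (Rpower q (rho / 2)) n m).
Proof.
unfold Amat, exp_kernel; f_equal.
rewrite <- !Rpower_pow by (unfold Rpower; apply exp_pos).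
rewrite !Rpower_mult; unfold Rdiv at 1.
rewrite <- Rpower_Ropp, <- !Rpower_plus; f_equal.
rewrite minus_INR by lia.
assert (E : INR (n + m) = INR (Nat.max n m) + INR (Nat.min n m)).
{ rewrite <- plus_INR; f_equal; lia. }
rewrite E; field.
Qed.

Fixpoint damped_sum (a : R) (x : nat -> C) (N : nat) : C :=
  match N with
  | 0%nat => x 0%nat
  | S N => (RtoC a * damped_sum a x N + x (S N))%C
  end.

(** Equations between values of [sum_n] live in the carrier of an abelian
    monoid, which [ring] has to be shown as [C]. *)
Local Ltac Cring :=
  match goal with |- @eq _ ?z ?w => change (@eq C z w) end; ring.

Lemma exp_kernel_row_sum (a b : R) (f : nat -> C) (N M : nat) : (N <= M)%nat ->
  sum_n (fun n => RtoC (exp_kernel a b n M) * f n)%C N =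
  (RtoC (a ^ (M - N) * b ^ M) * damped_sum a (fun n => RtoC (b ^ n) * f n) N)%C.
Proof.
induction N as [|N IH]; intros hN.
- rewrite sum_O, exp_kernel_sym, exp_kernel_col0, Nat.sub_0_r, Rpow_mult_distr.
  simpl damped_sum; rewrite !RtoC_mult; simpl; Cring.
- rewrite sum_Sn, IH by lia.
  change plus with Cplus; simpl damped_sum.
  unfold exp_kernel; rewrite Nat.max_r, Nat.min_l, pow_add by lia.
  replace (M - N)%nat with (S (M - S N)) by lia.
  change (a ^ S (M - S N)) with (a * a ^ (M - S N)).
  change (b ^ S N) with (b * b ^ N).
  rewrite !RtoC_mult; Cring.
Qed.

(** With [x n = b ^ n * f n] and the damped sums
    [S N = sum_(n <= N) a ^ (N - n) * x n], the truncated form [Q N] satisfies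
    [Q (N + 1) - |S (N + 1)| ^ 2 = Q N - a ^ 2 |S N| ^ 2], so [Q N >= |S N| ^ 2]
    is preserved when [a ^ 2 <= 1]. *)
Lemma exp_kernel_psd (a b : R) : 0 <= a <= 1 ->
  positive_semidefinite (fun n m => RtoC (exp_kernel a b n m)).
Proof.
intros ha f N _.
set (x := fun n => (RtoC (b ^ n) * f n)%C).
set (t := fun n m => (RtoC (exp_kernel a b n m) * f n * Cconj (f m))%C).
enough (H : exists s, sum_n (fun n => sum_n (t n) N) N = RtoC s /\
                      Cmod (damped_sum a x N) ^ 2 <= s).
{ destruct H as [s [Es Hs]].
  change (Cnonneg (sum_n (fun n => sum_n (t n) N) N)).
  rewrite Es; split; simpl; [|reflexivity].
  generalize (pow2_ge_0 (Cmod (damped_sum a x N))); lra. }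
assert (Hrow : forall N, sum_n (fun n => t n (S N)) N =
                 (RtoC a * damped_sum a x N * Cconj (x (S N)))%C).
{ intros k; rewrite (sum_n_ext _ (fun n =>
    mult (RtoC (exp_kernel a b n (S k)) * f n)%C (Cconj (f (S k))))) by reflexivity.
  rewrite sum_n_mult_r, exp_kernel_row_sum by lia.
  replace (S k - k)%nat with 1%nat by lia; change mult with Cmult; fold x.
  unfold x at 3; rewrite !RtoC_mult, Cmult_conj.
  destruct (f (S k)), (damped_sum a x k); apply injective_projections;
    simpl; ring. }
assert (Hcol : forall N, sum_n (t (S N)) N =
                 Cconj (sum_n (fun n => t n (S N)) N)).
{ intros k.
  assert (E : forall j, t (S k) j = Cconj (t j (S k))).
  { intros j; unfold t; rewrite exp_kernel_sym; destruct (f j), (f (S k)).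
    apply injective_projections; simpl; ring. }
  generalize k at 2 4; intros j; induction j as [|j IH].
  - rewrite !sum_O; apply E.
  - rewrite !sum_Sn, IH, E; change plus with Cplus; symmetry; apply Cplus_conj. }
induction N as [|N [s [Es Hs]]].
- exists (Cmod (x 0%nat) ^ 2); rewrite !sum_O; split; [|apply Rle_refl].
  unfold t; rewrite exp_kernel_diag, Cmod2_alt; unfold x.
  destruct (f 0%nat); apply injective_projections; simpl; ring.
- set (y := x (S N)); set (d := damped_sum a x N) in *.
  exists (s + 2 * a * (Re d * Re y + Im d * Im y) + Cmod y ^ 2); split.
  + rewrite sum_Sn.
    rewrite (sum_n_ext (fun n => sum_n (t n) (S N))
               (fun n => plus (sum_n (t n) N) (t n (S N))))
      by (intros n; apply sum_Sn).
    rewrite sum_n_plus, sum_Sn, Hcol, Hrow, Es; change plus with Cplus.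
    assert (Et : t (S N) (S N) = RtoC (Cmod y ^ 2)).
    { unfold t, y, x; rewrite exp_kernel_diag, Cmod2_alt, pow_add.
      destruct (f (S N)); apply injective_projections; simpl; ring. }
    rewrite Et; fold y d.
    destruct d, y; apply injective_projections; simpl; ring.
  + simpl damped_sum; fold d y.
    rewrite Cmod2_alt in Hs |- *; rewrite Cmod2_alt.
    assert (H : 0 <= (1 - a ^ 2) * (Re d ^ 2 + Im d ^ 2)).
    { apply Rmult_le_pos; [nra|].
      generalize (pow2_ge_0 (Re d)) (pow2_ge_0 (Im d)); lra. }
    destruct d as [d1 d2], y as [y1 y2]; simpl Re in *; simpl Im in *.
    nra.
Qed.

(** With truncated subtraction the bound reads [a ^ (n - N) / (1 - a)] up to the
    diagonal and [(2 - a ^ (N - n)) / (1 - a)] beyond it, where the induction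
    step is [a * (2 - a) <= 1]. *)
Lemma exp_kernel_toeplitz_row_sum (a : R) (n N : nat) : 0 < a < 1 ->
  sum_n (exp_kernel a 1 n) N <= (a ^ (n - N) + 1 - a ^ (N - n)) / (1 - a).
Proof.
intros ha; unfold exp_kernel.
assert (Hstep : forall u v w, u * (1 - a) + v <= w -> v / (1 - a) + u <= w / (1 - a)).
{ intros u v w H; apply Rmult_le_reg_r with (1 - a); [lra|].
  replace ((v / (1 - a) + u) * (1 - a)) with (u * (1 - a) + v) by (field; lra).
  replace (w / (1 - a) * (1 - a)) with w by (field; lra); exact H. }
induction N as [|N IH].
- rewrite sum_O, Nat.max_0_r, Nat.min_0_r, Nat.sub_0_r, pow1; simpl (a ^ (0 - n)).
  assert (h : 0 < a ^ n) by (apply pow_lt; lra).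
  replace (a ^ n * 1) with (0 / (1 - a) + a ^ n) by (field; lra).
  apply Hstep; nra.
- rewrite sum_Sn; change plus with Rplus.
  eapply Rle_trans; [apply Rplus_le_compat_r, IH|].
  rewrite pow1, Rmult_1_r; apply Hstep.
  destruct (Nat.le_gt_cases n N) as [h|h].
  + rewrite Nat.max_r, Nat.min_l by lia.
    replace (n - N)%nat with 0%nat by lia.
    replace (n - S N)%nat with 0%nat by lia.
    replace (S N - n)%nat with (S (N - n)) by lia.
    assert (hp : 0 < a ^ (N - n)) by (apply pow_lt; lra).
    simpl; generalize (pow2_ge_0 (1 - a)); nra.
  + rewrite Nat.max_l, Nat.min_r by lia.
    replace (N - n)%nat with 0%nat by lia.
    replace (S N - n)%nat with 0%nat by lia.
    replace (n - N)%nat with (S (n - S N)) by lia.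
    simpl; lra.
Qed.

Lemma exp_kernel_toeplitz_bounded (a : R) : 0 < a < 1 ->
  bounded_matrix (fun n m => RtoC (exp_kernel a 1 n m)).
Proof.
intros ha; apply schur_test with (2 / (1 - a)).
- intros n m; unfold exp_kernel; rewrite pow1, Rmult_1_r; apply pow_le; lra.
- apply exp_kernel_sym.
- intros n N; eapply Rle_trans; [now apply exp_kernel_toeplitz_row_sum|].
  apply Rmult_le_compat_r; [left; apply Rinv_0_lt_compat; lra|].
  assert (h1 : 0 < a ^ (N - n)) by (apply pow_lt; lra).
  assert (h2 : a ^ (n - N) <= 1 ^ (n - N)) by (apply pow_incr; lra).
  rewrite pow1 in h2; lra.
Qed.

Lemma exp_kernel_trace_class (a b c : R) :
  0 < a -> 0 < b -> 0 < c < 1 -> b <= c -> a * b <= c ->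
  bounded_matrix (fun n m => RtoC (exp_kernel a b n m)) /\
  compact_matrix (fun n m => RtoC (exp_kernel a b n m)) /\
  trace_class_matrix (fun n m => RtoC (exp_kernel a b n m)).
Proof.
intros ha hb hc hbc habc; apply geometric_decay_matrix with c;
  [exact hc| |apply exp_kernel_sym].
intros n m; unfold exp_kernel; split.
- apply Rmult_le_pos; apply pow_le; lra.
- set (d := (Nat.max n m - Nat.min n m)%nat).
  replace (n + m)%nat with (d + (n + m - d))%nat by lia.
  rewrite !pow_add, <- Rmult_assoc, <- Rpow_mult_distr.
  apply Rmult_le_compat; try (apply pow_le; nra); apply pow_incr; nra.
Qed.

Lemma exp_kernel_bounded_col0 (a b : R) : 0 < a -> 0 < b ->
  bounded_matrix (fun n m => RtoC (exp_kernel a b n m)) -> a * b < 1.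
Proof.
intros ha hb H; apply Rnot_le_lt; intros h.
apply (bounded_matrix_column _ 0), ex_series_lim_0, is_lim_seq_spec in H.
destruct (H (mkposreal 1 Rlt_0_1)) as [N HN].
specialize (HN N (Nat.le_refl N)); simpl in HN.
rewrite exp_kernel_col0, Cmod_R, Rminus_0_r, Rmult_1_r in HN.
assert (h1 : 1 <= (a * b) ^ N) by now apply pow_R1_Rle.
rewrite (Rabs_pos_eq ((a * b) ^ N)) in HN by lra.
rewrite Rabs_pos_eq in HN; nra.
Qed.

Lemma exp_kernel_toeplitz_not_compact (a : R) : 0 < a < 1 ->
  ~ compact_matrix (fun n m => RtoC (exp_kernel a 1 n m)).
Proof.
intros ha; apply not_compact_matrix.
- intros n; apply (is_lim_seq_incr_n _ n).
  apply is_lim_seq_ext with (fun k => a ^ k).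
  + intros k; unfold exp_kernel.
    rewrite Nat.max_r, Nat.min_l, pow1, Rmult_1_r by lia.
    replace (k + n - n)%nat with k by lia.
    rewrite Cmod_R, Rabs_pos_eq; [reflexivity|apply pow_le; lra].
  + apply is_lim_seq_geom; rewrite Rabs_pos_eq; lra.
- intros n; rewrite exp_kernel_diag, pow1, Cmod_1; apply Rle_refl.
Qed.

Lemma exp_kernel_unbounded (a b : R) : 1 < b ->
  ~ bounded_matrix (fun n m => RtoC (exp_kernel a b n m)).
Proof.
intros hb H; destruct (bounded_matrix_entries _ H) as [M HM].
destruct (Pow_x_infinity b) with (b := M + 1) as [N HN].
{ rewrite Rabs_pos_eq; lra. }
assert (h1 := HM N N); assert (h2 := HN (N + N)%nat ltac:(lia)).
rewrite exp_kernel_diag, Cmod_R in h1; lra.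
Qed.

Theorem mainTheorem4 (q tau rho : R) (hq : 0 < q < 1) :
  (0 < tau ->
     positive_semidefinite (Amat q tau rho) /\
     (0 < rho ->
        bounded_matrix (Amat q tau rho) /\
        compact_matrix (Amat q tau rho) /\
        trace_class_matrix (Amat q tau rho)) /\
     (rho = 0 ->
        bounded_matrix (Amat q tau rho) /\ ~ compact_matrix (Amat q tau rho)) /\
     (rho < 0 -> ~ bounded_matrix (Amat q tau rho))) /\
  (tau = 0 ->
     formally_rank_one (Amat q tau rho) /\
     (bounded_matrix (Amat q tau rho) <-> 0 < rho)) /\
  (tau < 0 ->
     (bounded_matrix (Amat q tau rho) <-> 0 < rho + tau) /\
     (bounded_matrix (Amat q tau rho) ->
        compact_matrix (Amat q tau rho) /\ trace_class_matrix (Amat q tau rho))).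
Proof.
set (a := Rpower q (tau / 2)); set (b := Rpower q (rho / 2)).
assert (EA : Amat q tau rho = fun n m => RtoC (exp_kernel a b n m)).
{ apply functional_extensionality; intros n.
  apply functional_extensionality; intros m; apply Amat_exp_kernel. }
assert (ha : 0 < a) by (unfold a, Rpower; apply exp_pos).
assert (hb : 0 < b) by (unfold b, Rpower; apply exp_pos).
assert (hlt : forall x, 0 < x -> Rpower q x < 1).
{ intros x hx; rewrite <- (exp_0); unfold Rpower; apply exp_increasing.
  assert (hln : ln q < 0) by (rewrite <- ln_1; apply ln_increasing; lra); nra. }
assert (hgt : forall x, x < 0 -> 1 < Rpower q x).
{ intros x hx; rewrite <- (exp_0); unfold Rpower; apply exp_increasing.
  assert (hln : ln q < 0) by (rewrite <- ln_1; apply ln_increasing; lra); nra. }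
assert (h0 : Rpower q 0 = 1) by (apply Rpower_O; lra).
assert (hab : a * b = Rpower q ((rho + tau) / 2)).
{ unfold a, b; rewrite <- Rpower_plus; f_equal; field. }
assert (hab1 : a * b < 1 <-> 0 < rho + tau).
{ rewrite hab; split; intros h; [|apply hlt; lra].
  apply Rnot_le_lt; intros [h'|h'].
  - assert (H := hgt ((rho + tau) / 2)); lra.
  - rewrite h' in h; unfold Rdiv in h; rewrite Rmult_0_l, h0 in h; lra. }
rewrite EA; split; [|split]; intros htau.
- assert (ha1 : a < 1) by (apply hlt; lra).
  split; [|split; [|split]].
  + apply exp_kernel_psd; lra.
  + intros hrho; assert (hb1 : b < 1) by (apply hlt; lra).
    apply exp_kernel_trace_class with b; nra.
  + intros hrho.
    assert (hb1 : b = 1).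
    { unfold b; rewrite hrho; unfold Rdiv; now rewrite Rmult_0_l. }
    rewrite hb1; split.
    * apply exp_kernel_toeplitz_bounded; lra.
    * apply exp_kernel_toeplitz_not_compact; lra.
  + intros hrho; apply exp_kernel_unbounded, hgt; lra.
- assert (ha1 : a = 1).
  { unfold a; rewrite htau; unfold Rdiv; now rewrite Rmult_0_l. }
  split.
  + exists (fun n => RtoC (b ^ n)); split.
    * exists 0%nat; intros E; apply (f_equal Re) in E; simpl in E; lra.
    * intros n m; unfold exp_kernel.
      now rewrite ha1, pow1, Rmult_1_l, pow_add, RtoC_mult.
  + split.
    * intros H; apply exp_kernel_bounded_col0 in H; [|exact ha|exact hb].
      apply hab1 in H; lra.
    * intros hrho; assert (hb1 : b < 1) by (apply hlt; lra).
      apply exp_kernel_trace_class with b; nra.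
- assert (ha1 : 1 < a) by (apply hgt; lra).
  assert (Hdecay : 0 < rho + tau ->
    bounded_matrix (fun n m => RtoC (exp_kernel a b n m)) /\
    compact_matrix (fun n m => RtoC (exp_kernel a b n m)) /\
    trace_class_matrix (fun n m => RtoC (exp_kernel a b n m))).
  { intros h; apply hab1 in h.
    apply exp_kernel_trace_class with (a * b); nra. }
  assert (Hcol : bounded_matrix (fun n m => RtoC (exp_kernel a b n m)) ->
                 0 < rho + tau).
  { intros H; apply hab1; now apply exp_kernel_bounded_col0. }
  split; [split|]; [exact Hcol|apply Hdecay|].
  intros H; apply Hdecay, Hcol, H.
Qed.
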